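(* Let $X$ be a smooth hypersurface in $\mathbb{P}^N$ of degree $d\ge 3$ and let $\mathbb{F}(X)$ be its Fano scheme of lines. Then there do not exist an $(N-2)$-dimensional subset $B\subset\mathbb{F}(X)$ and a curve $\Gamma\subset X$ such that each line of $B$ meets $\Gamma$.
   Context: The base field is $\mathbb{C}$ and $N\ge 2$. The Fano scheme $\mathbb{F}(X)$ is the scheme parametrizing the lines of $\mathbb{P}^N$ contained in $X$, a closed subscheme of the Grassmannian of lines in $\mathbb{P}^N$. *)

(* Defs.v *)
From HB Require Import structures.
From mathcomp Require Import all_boot all_order all_algebra.
From mathcomp Require Import mpoly complex.
From mathcomp Require Import boolp classical_sets reals.

Set Implicit Arguments.
Unset Strict Implicit.
Unset Printing Implicit Defensive.

Import GRing.Theory.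

Local Open Scope classical_set_scope.
Local Open Scope ring_scope.

Section KrullDimension.
(* [closed] is the family of closed sets of a topology on [T]. *)
Variables (T : Type) (closed : set T -> Prop).

Definition irreducible_set (Z : set T) : Prop :=
  Z !=set0 /\
  forall A1 A2 : set T, closed A1 -> closed A2 ->
    Z `<=` A1 `|` A2 -> Z `<=` A1 \/ Z `<=` A2.

Definition closed_in (B Z : set T) : Prop :=
  exists A : set T, closed A /\ Z = B `&` A.

Definition has_chain (B : set T) (n : nat) : Prop :=
  exists Z : nat -> set T,
    (forall i, (i <= n)%N -> closed_in B (Z i) /\ irreducible_set (Z i)) /\
    (forall i, (i < n)%N -> Z i `<` Z i.+1).

(* [B] has Krull dimension [n] for the subspace topology.  The empty set has
   no dimension in this sense. *)
Definition krull_dim_eq (B : set T) (n : nat) : Prop :=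
  has_chain B n /\ ~ has_chain B n.+1.

End KrullDimension.

Section ProjectiveGeometry.
Variables (K : fieldType) (N : nat).

(* Points and lines of P^N are the linear subspaces of K^(N+1) of dimension
   1 and 2; a point lies on a line when it is a subspace of it. *)
Definition proj_point : Type := {p : {vspace 'rV[K]_N.+1} | \dim p == 1%N}.
Definition proj_line : Type := {L : {vspace 'rV[K]_N.+1} | \dim L == 2%N}.

Definition on_line (p : proj_point) (L : proj_line) : Prop :=
  (val p <= val L)%VS.

Definition vanishes_at (f : {mpoly K[N.+1]}) (p : proj_point) : Prop :=
  forall v : 'rV[K]_N.+1, v \in val p -> f.@[v 0] = 0.

Definition zariski_closed (Z : set proj_point) : Prop :=
  exists S : set {mpoly K[N.+1]},
    (forall f, S f -> exists d : nat, f \is d.-homog) /\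
    Z = [set p | forall f, S f -> vanishes_at f p].

(* The exterior product of u and v, as an alternating matrix with entries
   u_i v_j - u_j v_i.  When u and v run over a line L, it runs over the point
   of P^((N+1)^2-1) that is the image of L by the Pluecker embedding. *)
Definition plucker (u v : 'rV[K]_N.+1) : 'rV[K]_(N.+1 * N.+1) :=
  mxvec (u^T *m v - v^T *m u).

Definition vanishes_at_line (g : {mpoly K[N.+1 * N.+1]})
    (L : proj_line) : Prop :=
  forall u v : 'rV[K]_N.+1, u \in val L -> v \in val L ->
    g.@[plucker u v 0] = 0.

(* The Zariski topology of the Grassmannian of lines: the topology induced by
   the Pluecker embedding. *)
Definition zariski_closed_lines (Z : set proj_line) : Prop :=
  exists S : set {mpoly K[N.+1 * N.+1]},
    (forall g, S g -> exists d : nat, g \is d.-homog) /\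
    Z = [set L | forall g, S g -> vanishes_at_line g L].

Definition hypersurface (f : {mpoly K[N.+1]}) : set proj_point :=
  [set p | vanishes_at f p].

(* Jacobian criterion for the scheme f = 0; it forces f to be nonzero. *)
Definition smooth_hypersurface (f : {mpoly K[N.+1]}) : Prop :=
  forall p : proj_point, hypersurface f p ->
    exists i : 'I_N.+1, ~ vanishes_at f^`M(i) p.

(* The closed points of the Fano scheme of lines of f = 0.  Its scheme
   structure plays no role in the dimension of subsets. *)
Definition fano_lines (f : {mpoly K[N.+1]}) : set proj_line :=
  [set L | forall p : proj_point, on_line p L -> hypersurface f p].

(* Curves may be reducible and need not be equidimensional. *)
Definition is_curve (G : set proj_point) : Prop :=
  zariski_closed G /\ krull_dim_eq zariski_closed G 1.

End ProjectiveGeometry.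

(* Main.v *)
Require Import Defs.
From HB Require Import structures.
From mathcomp Require Import all_boot all_order all_algebra.
From mathcomp Require Import mpoly complex.
From mathcomp Require Import boolp classical_sets cardinality filter reals.
From mathcomp Require Import generic_quotient.
From mathcomp Require Import zify ring lra.

(** Suppose that the lines of an [(N - 2)]-dimensional family [B] in [X], defined
    by the form [f] of degree [d], all meet a curve [Gamma], and look at a
    generic line [L] of [B], spanned by a point [p] of [Gamma] and a vector [v].
    It is defined over an extension [K] of the base field [F].  Derivations of
    [K] over [F] play the part of tangent vectors to [B]: there are [N - 1]
    independent ones on the homogeneous coordinates of [L], and they all move [p]
    in a single direction [p'], as [Gamma] is a curve.  So [N - 2] independent
    derivations [theta] fix [p].

    Differentiating [f = 0] along [L] shows that the gradient of [f] on [L] is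
    orthogonal to the space [E] spanned by [p] and the [theta v].  By smoothness
    [E] has dimension exactly [N - 1], so that the gradient on [L] reduces to two
    binary forms of degree [d - 1] without common zero ([tangent_rank_le]).  Any
    derivation provides a syzygy between them with linear coefficients; as
    [d - 1 >= 2], this syzygy is trivial ([deformation_submx]), which means that
    every derivation moves [L] inside [E].  If [N <= 3] then [E] is [L], which
    does not move: a contradiction.  If [N >= 4], then [p'] lies in [E], and it
    follows that [X] contains the plane spanned by [p], [p'] and [v], and that
    [E] is the intersection of the hyperplanes tangent to [X] along the line
    [p p'].  This line is fixed by the [theta], hence so is [E], and then [f]
    vanishes on [E] ([E_in_h]).  A smooth hypersurface does not contain a linear
    space of dimension [N - 2 >= 2], since two forms in at least three variables
    have a common zero ([common_zero]).

    The generic line is obtained as follows.  A chain of irreducible closed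
    subsets of [B] provides [N - 1] forms in the Pluecker coordinates that are
    algebraically independent on [B] ([chain_indep]).  The field [K] is an
    ultrapower of [F] along an ultrafilter for which no nonzero polynomial in
    these forms vanishes; it is algebraically closed, and smoothness passes to
    it.  Algebraic independence yields the dual derivations
    ([exists_dual_derivation]).  That [p] moves in a single direction comes from
    an algebraic relation on [Gamma] between any three coordinates
    ([curve_coordinates]).  Such a relation exists because two linear forms have
    no common zero on the relevant component of [Gamma]; by a graded
    Nullstellensatz, its homogeneous coordinate ring is then finite over the
    subring generated by these two forms, and grows too slowly to contain three
    independent coordinates. *)

Set Implicit Arguments.
Unset Strict Implicit.
Unset Printing Implicit Defensive.

Import Order.TTheory GRing.Theory Num.Theory.

Local Open Scope classical_set_scope.
Local Open Scope ring_scope.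

(** * Differential calculus of multivariate polynomials *)

Section Mpoly.
Variable n : nat.
Variable R : comNzRingType.
Implicit Types (g p q : {mpoly R[n]}) (x w : 'rV[R]_n).

Definition coefmap (theta : R -> R) p : {mpoly R[n]} :=
  \sum_(m <- msupp p) theta p@_m *: 'X_[m].

Lemma mcoeff_coefmap (theta : R -> R) p m :
  theta 0 = 0 -> (coefmap theta p)@_m = theta p@_m.
Proof.
move=> th0; rewrite /coefmap raddf_sum /=.
have [mp|mp] := boolP (m \in msupp p); last first.
  rewrite (memN_msupp_eq0 mp) th0 big_seq big1 // => k kp.
  rewrite mcoeffZ mcoeffX; case: eqP => [km|]; last by rewrite mulr0.
  by rewrite -km kp in mp.
rewrite (bigD1_seq m) //= mcoeffZ mcoeffX eqxx mulr1 big1 ?addr0 // => k km.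
by rewrite mcoeffZ mcoeffX (negPf km) mulr0.
Qed.

Lemma coefmapD (theta : R -> R) : (forall c d, theta (c + d) = theta c + theta d) ->
  theta 0 = 0 -> {morph coefmap theta : p q / p + q}.
Proof.
by move=> thD th0 p q; apply/mpolyP => m; rewrite mcoeffD !mcoeff_coefmap // mcoeffD.
Qed.

(** The chain rule, for a derivation [D] that need not kill the coefficients:
    [theta] is what it induces on them.  It serves both for [deriv] on
    univariate polynomials and for derivations of a field. *)
Lemma derivation_mmap (A : comNzRingType) (f : {rmorphism R -> A})
    (h : 'I_n -> A) (D : A -> A) (theta : R -> R) p :
    (forall a b, D (a + b) = D a + D b) ->
    (forall a b, D (a * b) = D a * b + a * D b) ->
    theta 0 = 0 ->
    (forall c, D (f c) = f (theta c)) ->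
    (forall c d, theta (c + d) = theta c + theta d) ->
  D (mmap f h p) =
    mmap f h (coefmap theta p) + \sum_i mmap f h p^`M(i) * D (h i).
Proof.
move=> DD DM th0 Df thD.
have D0 : D 0 = 0 by rewrite -(rmorph0 f) Df th0.
have D1 : D 1 = 0.
  by have := DM 1 1; rewrite !mulr1 mul1r -[LHS]addr0 => /addrI/esym.
have DX m : D (mmap f h 'X_[m]) = \sum_i mmap f h 'X_[m]^`M(i) * D (h i).
  rewrite [m]multinomUE_id.
  pose Q m := D (mmap f h 'X_[m]) = \sum_i mmap f h 'X_[m]^`M(i) * D (h i).
  have Q0 : Q 0%MM.
    rewrite /Q mpolyX0 rmorph1 D1 big1 // => i _.
    by rewrite -mpolyC1 mderivC mmap0 mul0r.
  have QM a b : Q a -> Q b -> Q (a + b)%MM.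
    rewrite /Q mpolyXD rmorphM /= DM => -> ->.
    rewrite mulr_suml mulr_sumr -big_split /=; apply: eq_bigr => i _.
    by rewrite mderivM mmapD !rmorphM /= mulrDl mulrAC mulrA.
  rewrite -/(Q _); elim/big_ind: _ => // i _.
  elim: (m i) => [|k IH]; first by rewrite mulm0n.
  rewrite mulmS; apply: QM => //.
  rewrite /Q mmapX mmap1U (bigD1 i) //= mderivX mnm1E eqxx scale1r.
  rewrite [X in 'X_[X]](_ : _ = 0%MM); last first.
    by apply/mnmP => j; rewrite mnmBE mnm0E subnn.
  rewrite mpolyX0 rmorph1 mul1r big1 ?addr0 // => j ji.
  by rewrite mderivX mnm1E eq_sym (negPf ji) scale0r mmap0 mul0r.
elim/mpolyind: p => [|c m p _ _ IH].
  rewrite mmap0 D0 /coefmap msupp0 big_nil mmap0 add0r big1 // => i _.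
  by rewrite mderiv0 mmap0 mul0r.
have DcX : D (mmap f h (c *: 'X_[m])) = mmap f h (coefmap theta (c *: 'X_[m])) +
    \sum_i mmap f h (c *: 'X_[m])^`M(i) * D (h i).
  have -> : coefmap theta (c *: 'X_[m]) = theta c *: 'X_[m].
    apply/mpolyP => k; rewrite mcoeff_coefmap // !mcoeffZ mcoeffX.
    by case: eqP; rewrite ?mulr1 ?mulr0.
  rewrite !mmapZ DM Df DX; congr (_ + _); rewrite big_distrr.
  apply: eq_bigr => i _ /=; by rewrite mderivZ mmapZ mulrA.
rewrite mmapD DD DcX IH addrACA coefmapD // mmapD -big_split /=.
by congr (_ + _); apply: eq_bigr => i _; rewrite mderivD mmapD mulrDl.
Qed.

Lemma deriv_mmap (A : comNzRingType) (f : {rmorphism R -> A})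
    (h : 'I_n -> A) (D : A -> A) p :
    (forall a b, D (a + b) = D a + D b) ->
    (forall a b, D (a * b) = D a * b + a * D b) ->
    (forall c, D (f c) = 0) ->
  D (mmap f h p) = \sum_i mmap f h p^`M(i) * D (h i).
Proof.
move=> DD DM Df; rewrite (@derivation_mmap _ _ _ _ (fun=> 0)) //.
- rewrite /coefmap big1 ?mmap0 ?add0r // => m _; exact: scale0r.
- by move=> c; rewrite rmorph0.
- by move=> *; rewrite addr0.
Qed.

Definition dirderiv w p : {mpoly R[n]} := \sum_i w 0 i *: p^`M(i).

Lemma dirderiv0 w : dirderiv w 0 = 0.
Proof. by rewrite /dirderiv big1 // => i _; rewrite mderiv0 scaler0. Qed.

Lemma meval_dirderiv w p x : (dirderiv w p).@[x 0] = \sum_i w 0 i * p^`M(i).@[x 0].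
Proof. by rewrite raddf_sum; apply: eq_bigr => i _; rewrite /= mevalZ. Qed.

Lemma meval_dirderivD w1 w2 p x :
  (dirderiv (w1 + w2) p).@[x 0] = (dirderiv w1 p).@[x 0] + (dirderiv w2 p).@[x 0].
Proof.
by rewrite !meval_dirderiv -big_split; apply: eq_bigr => i _; rewrite mxE mulrDl.
Qed.

Lemma meval_dirderivZ c w p x :
  (dirderiv (c *: w) p).@[x 0] = c * (dirderiv w p).@[x 0].
Proof.
by rewrite !meval_dirderiv mulr_sumr; apply: eq_bigr => i _; rewrite mxE mulrA.
Qed.

Lemma meval_dirderiv_delta i p x :
  (dirderiv (delta_mx 0 i) p).@[x 0] = p^`M(i).@[x 0].
Proof.
rewrite meval_dirderiv (bigD1 i) //= mxE !eqxx mul1r big1 ?addr0 // => j ji.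
by rewrite mxE (negPf ji) andbF mul0r.
Qed.

Lemma dhomog_mderiv d i p : p \is d.-homog -> p^`M(i) \is d.-1.-homog.
Proof.
move=> /dhomogP hp; apply/dhomogP => m.
rewrite mcoeff_msupp mcoeff_deriv => pm.
have : (m + U_(i))%MM \in msupp p.
  by rewrite mcoeff_msupp; apply: contra pm => /eqP ->; rewrite mul0rn.
by move=> /hp <-; rewrite /= mdegD mdeg1 addn1.
Qed.

Lemma dhomog_dirderiv d w p : p \is d.-homog -> dirderiv w p \is d.-1.-homog.
Proof.
by move=> hp; apply: rpred_sum => i _; apply: rpredZ; apply: dhomog_mderiv.
Qed.

Lemma meval_dhomogZ d p c x : p \is d.-homog -> p.@[(c *: x) 0] = c ^+ d * p.@[x 0].
Proof.
move=> /dhomogP hp; rewrite !mevalE mulr_sumr; apply: eq_big_seq => m /hp <-.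
rewrite /= mulrCA; congr (_ * _); rewrite mdegE -prodrXr -big_split /=.
by apply: eq_bigr => i _; rewrite mxE exprMn.
Qed.

Definition restr_line p x w : {poly R} :=
  mmap polyC (fun i => (x 0 i)%:P + (w 0 i)%:P * 'X) p.

Lemma horner_restr_line p x w t : (restr_line p x w).[t] = p.@[(x + t *: w) 0].
Proof.
rewrite /restr_line /mmap horner_sum mevalE; apply: eq_bigr => m _.
rewrite hornerM hornerC horner_prod; congr (_ * _); apply: eq_bigr => i _.
by rewrite horner_exp !hornerE !mxE mulrC.
Qed.

Lemma deriv_restr_line p x w :
  (restr_line p x w)^`() = restr_line (dirderiv w p) x w.
Proof.
rewrite /restr_line (@deriv_mmap _ polyC _ (@deriv R)); first last.
- by move=> c; rewrite derivC.
- by move=> a b; rewrite derivM.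
- by move=> a b; rewrite derivD.
rewrite /dirderiv raddf_sum; apply: eq_bigr => i _ /=.
by rewrite mmapZ derivD derivC add0r deriv_mulC derivX mulr1 mulrC.
Qed.

End Mpoly.

Section FieldMpoly.
Variables (n : nat) (K : fieldType).
Hypothesis char0 : forall k, k.+1%:R != 0 :> K.
Implicit Types (g p q : {mpoly K[n]}) (x w : 'rV[K]_n).

Lemma natr_inj : injective (fun k : nat => k%:R : K).
Proof.
suff H a b : (a <= b)%N -> a%:R = b%:R :> K -> a = b.
  move=> a b; case: (leqP a b) => [|/ltnW] /H h; first exact: h.
  by move=> /esym /h.
move=> ab /eqP; rewrite eq_sym -subr_eq0 -natrB // => h; apply/eqP.
rewrite eqn_leq ab -subn_eq0; case: (b - a)%N h => // k h.
by rewrite (negPf (char0 k)) in h.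
Qed.

Lemma poly_ext0 (P : {poly K}) : (forall t, t != 0 -> P.[t] = 0) -> P = 0.
Proof.
move=> P0; apply/eqP; apply: contraT => nzP.
pose s := [seq k.+1%:R : K | k <- iota 0 (size P)].
have := @max_poly_roots _ P s nzP.
rewrite size_map size_iota ltnn => h; apply: h.
  by apply/allP => _ /mapP[k _ ->]; rewrite /root P0.
by rewrite map_inj_uniq ?iota_uniq // => a b /natr_inj [].
Qed.

(** Euler's identity: both sides are the derivative at [t = 0] of
    [p ((1 + t) x)]. *)
Lemma euler d p x : p \is d.-homog -> (dirderiv x p).@[x 0] = d%:R * p.@[x 0].
Proof.
move=> hp; have := congr1 (fun P : {poly K} => P.[0]) (deriv_restr_line p x x).
rewrite /= horner_restr_line scale0r addr0 => <-.
have -> : restr_line p x x = p.@[x 0] *: (1 + 'X) ^+ d.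
  apply/eqP; rewrite -subr_eq0; apply/eqP; apply: poly_ext0 => t _.
  rewrite !hornerE horner_restr_line -{1}[x]scale1r -scalerDl.
  by rewrite (meval_dhomogZ _ _ hp) mulrC subrr.
rewrite derivZ deriv_exp !derivE hornerZ hornerMn.
by rewrite !hornerE expr1n mulrC.
Qed.

Lemma dirderiv0_of_vanish p x w : (forall t, p.@[(x + t *: w) 0] = 0) ->
  (dirderiv w p).@[x 0] = 0.
Proof.
move=> h; have -> : x = x + 0 *: w by rewrite scale0r addr0.
rewrite -horner_restr_line -deriv_restr_line.
rewrite (_ : restr_line p x w = 0) ?deriv0 ?horner0 //.
by apply: poly_ext0 => t _; rewrite horner_restr_line.
Qed.

(** The coefficients of the restriction of [p] to the line are these derivatives,
    up to factorials. *)
Lemma taylor p x w :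
  (forall k, (iter k (dirderiv w) p).@[x 0] = 0) ->
  forall t, p.@[(x + t *: w) 0] = 0.
Proof.
move=> h t; rewrite -horner_restr_line.
suff -> : restr_line p x w = 0 by rewrite horner0.
have E k : (restr_line p x w)^`(k) = restr_line (iter k (dirderiv w) p) x w.
  by elim: k => [|k IH]; rewrite ?derivn0 // derivnS IH deriv_restr_line.
apply/polyP => k; rewrite coef0.
have := horner_restr_line (iter k (dirderiv w) p) x w 0.
rewrite scale0r addr0 h -E horner_coef0 coef_derivn addn0 ffactnn.
rewrite -mulr_natr => /eqP; rewrite mulf_eq0 => /orP[/eqP //|].
have := fact_gt0 k; case: (k`!)%N => // m _.
by rewrite (negPf (char0 m)).
Qed.

End FieldMpoly.

(** * Extension of derivations in characteristic zero *)

Definition derivation (K : fieldType) (delta : K -> K) : Prop :=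
  (forall a b, delta (a + b) = delta a + delta b) /\
  (forall a b, delta (a * b) = delta a * b + a * delta b).

Section Extension.
Variable K : fieldType.
Hypothesis char0 : forall k, k.+1%:R != 0 :> K.

(** A derivation from a subring of [K] to [K] is encoded by its graph: a subset
    of [K * K] that is a subring of the dual numbers [K[eps]] and contains no
    nonzero multiple of [eps]. *)
Definition derivation_graph (S : set (K * K)) : Prop :=
  [/\ S (1, 0),
      forall a b, S a -> S b -> S (a.1 - b.1, a.2 - b.2),
      forall a b, S a -> S b -> S (a.1 * b.1, a.1 * b.2 + a.2 * b.1) &
      forall b, S (0, b) -> b = 0].

Section OneStep.
Variable S : set (K * K).
Hypothesis gS : derivation_graph S.

Let S1 : S (1, 0). Proof. by case: gS. Qed.
Let SB a b : S a -> S b -> S (a.1 - b.1, a.2 - b.2). Proof. by case: gS a b. Qed.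
Let SM a b : S a -> S b -> S (a.1 * b.1, a.1 * b.2 + a.2 * b.1).
Proof. by case: gS a b. Qed.
Let Sfun b : S (0, b) -> b = 0. Proof. by case: gS b. Qed.
Let S0 : S (0, 0). Proof. by have := SB S1 S1; rewrite /= !subrr. Qed.
Let SD a b : S a -> S b -> S (a.1 + b.1, a.2 + b.2).
Proof.
move=> Sa Sb; have := SB Sa (SB S0 Sb).
by rewrite /= !opprB !subr0.
Qed.
Let SMn a c j : S (a, c) -> S (a *+ j, c *+ j).
Proof.
move=> Sac; elim: j => [|j IH]; first by rewrite !mulr0n.
by rewrite !mulrS; have := SD Sac IH.
Qed.
Let Ssum (I : Type) (r : seq I) (F G : I -> K) :
  (forall i, S (F i, G i)) -> S (\sum_(i <- r) F i, \sum_(i <- r) G i).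
Proof.
move=> h; elim: r => [|i r IH]; first by rewrite !big_nil.
by rewrite !big_cons; have := SD (h i) IH.
Qed.

Definition coef_graph (P Q : {poly K}) := forall i, S (P`_i, Q`_i).

Let cB P Q P' Q' : coef_graph P Q -> coef_graph P' Q' -> coef_graph (P - P') (Q - Q').
Proof. by move=> h h' i; rewrite !coefB; have := SB (h i) (h' i). Qed.

Let cM P Q P' Q' : coef_graph P Q -> coef_graph P' Q' ->
  coef_graph (P * P') (P * Q' + Q * P').
Proof.
move=> h h' i; rewrite coefD !coefM -big_split /=.
by apply: Ssum => j; have := SM (h j) (h' (i - j)%N).
Qed.

Let cX : coef_graph 'X 0.
Proof. by move=> i; rewrite coefX coef0; case: eqP. Qed.

Let cC a b : S (a, b) -> coef_graph a%:P b%:P.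
Proof. by move=> h i; rewrite !coefC; case: eqP. Qed.

Let cXn k : coef_graph 'X^k 0.
Proof. by move=> i; rewrite coefXn coef0; case: eqP. Qed.

Variable x : K.

(** The value at [x + b eps] of the polynomial [P + Q eps]. *)
Definition dual_value b (P Q : {poly K}) := P^`().[x] * b + Q.[x].

Definition adjoin b : set (K * K) :=
  [set c | exists P Q, coef_graph P Q /\ c = (P.[x], dual_value b P Q)].

Lemma derivation_graph_adjoin b :
  (forall P Q, coef_graph P Q -> P.[x] = 0 -> dual_value b P Q = 0) ->
  derivation_graph (adjoin b).
Proof.
move=> hb; split.
- exists 1, 0; split; last by rewrite /dual_value derivC !hornerE.
  by move=> i; rewrite coef1 coef0; case: eqP.
- move=> _ _ [P [Q [h ->]]] [P' [Q' [h' ->]]]; exists (P - P'), (Q - Q').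
  split; first exact: cB.
  by rewrite /dual_value derivB !hornerE /=; congr (_, _); ring.
- move=> _ _ [P [Q [h ->]]] [P' [Q' [h' ->]]]; exists (P * P'), (P * Q' + Q * P').
  split; first exact: cM.
  by rewrite /dual_value derivM !hornerE /=; congr (_, _); ring.
- by move=> c [P [Q [h [P0 ->]]]]; apply: hb.
Qed.

Lemma adjoin_subset b : S `<=` adjoin b.
Proof.
move=> [a c] h; exists a%:P, c%:P; split; first exact: cC.
by rewrite /dual_value derivC !hornerE.
Qed.

Lemma adjoin_gen b : adjoin b (x, b).
Proof.
exists 'X, 0; split; first exact: cX.
by rewrite /dual_value derivX !hornerE.
Qed.

(** If [x] is algebraic over the domain of the derivation, its image is
    forced by a relation of minimal degree, which is separable since the
    characteristic is zero; otherwise any image will do. *)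
Lemma exists_derivative :
  exists b, forall P Q, coef_graph P Q -> P.[x] = 0 -> dual_value b P Q = 0.
Proof.
pose rel k := `[< exists P Q, [/\ coef_graph P Q, P != 0, P.[x] = 0 & size P = k] >].
have [ex|nex] := pselect (exists k, rel k); last first.
  exists 0 => P Q h Px; have P0 : P = 0.
    apply/eqP; apply: contraT => nzP; exfalso; apply: nex.
    by exists (size P); apply/asboolP; exists P, Q.
  rewrite /dual_value mulr0 add0r (_ : Q = 0) ?horner0 //.
  by apply/polyP => i; rewrite coef0; apply: Sfun; have := h i; rewrite P0 coef0.
have [k /asboolP[m [r [hm nzm mx sm]]] kmin] := ex_minnP ex.
have hm' : coef_graph m^`() r^`().
  move=> i; rewrite !coef_deriv.
  exact: SMn.
have dm_nz : m^`().[x] != 0.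
  apply/eqP => dmx.
  have nzdm : m^`() != 0.
    apply/eqP => dm0; have : (size m <= 1)%N.
      rewrite leqNgt; apply/negP => sm1.
      move/polyP/(_ (size m).-2): dm0; rewrite coef0 coef_deriv.
      have := lead_coef_eq0 m; rewrite (negPf nzm) lead_coefE.
      case: (size m) sm1 => [|[|j]] //= _ /negP mj /eqP.
      by rewrite -mulr_natr mulf_eq0 (negPf (char0 _)) orbF.
    move/size1_polyC => e; move: mx nzm.
    by rewrite e hornerC => ->; rewrite eqxx.
  have /kmin : rel (size m^`()) by apply/asboolP; exists m^`(), r^`().
  by rewrite -sm leqNgt lt_size_deriv.
have dvM b P1 Q1 P2 Q2 : dual_value b (P1 * P2) (P1 * Q2 + Q1 * P2) =
    P1.[x] * dual_value b P2 Q2 + dual_value b P1 Q1 * P2.[x].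
  by rewrite /dual_value derivM !(hornerD, hornerM); ring.
have dvB b P1 Q1 P2 Q2 : dual_value b (P1 - P2) (Q1 - Q2) =
    dual_value b P1 Q1 - dual_value b P2 Q2.
  by rewrite /dual_value derivB !hornerD !hornerN; ring.
exists (- r.[x] / m^`().[x]) => P Q; set b := _ / _.
have dvm : dual_value b m r = 0 by rewrite /dual_value /b; field.
have [l] := ubnP (size P); elim: l P Q => // l IH P Q szP h Px.
have [P0|nzP] := eqVneq P 0.
  rewrite /dual_value P0 derivC !horner0 mul0r add0r (_ : Q = 0) ?horner0 //.
  by apply/polyP => i; rewrite coef0; apply: Sfun; have := h i; rewrite P0 coef0.
have kP : (size m <= size P)%N.
  by rewrite sm; apply: kmin; apply/asboolP; exists P, Q.
have := cB (cM (cC (hm (size m).-1)) h)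
  (cM (cM (cC (h (size P).-1)) (cXn (size P - size m))) hm).
rewrite -!lead_coefE; set P2 := _ - _; set Q2 := _ - _ => h2.
have sP2 : (size P2 < l)%N.
  apply: leq_trans (_ : size P <= l)%N; last by rewrite -ltnS.
  rewrite -(prednK (_ : 0 < size P)%N) ?size_poly_gt0 // ltnS.
  apply/leq_sizeP => j; rewrite leq_eqVlt => /orP[/eqP <-|lt].
    rewrite coefB -mulrA !coefCM coefXnM -lead_coefE.
    rewrite ifF; last by move: kP nzP nzm; rewrite -!size_poly_gt0; lia.
    rewrite (_ : ((size P).-1 - _)%N = (size m).-1); last by move: kP nzP nzm; rewrite -!size_poly_gt0; lia.
    by rewrite -lead_coefE mulrC subrr.
  rewrite coefB -mulrA !coefCM coefXnM [P`_j]nth_default; last exact: leq_trans (leqSpred _) lt.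
  rewrite mulr0 sub0r; case: ifP => _; rewrite ?mulr0 ?oppr0 //.
  have lt' := leq_trans (leqSpred _) lt.
  by rewrite nth_default ?mulr0 ?oppr0 // leq_subRL ?subnK // (leq_trans (leq_subr _ _)).
have := IH _ _ sP2 h2; rewrite /P2 hornerD hornerN !hornerM mx Px !mulr0 subr0.
move=> /(_ erefl); rewrite dvB !dvM dvm Px mx !mulr0 hornerC !addr0 subr0.
by move=> /eqP; rewrite mulf_eq0 lead_coef_eq0 (negPf nzm) => /eqP.
Qed.

End OneStep.

(** A maximal derivation graph is defined everywhere, since any element can be
    adjoined to its domain. *)
Lemma extend_derivation S0 : derivation_graph S0 ->
  exists2 delta, derivation delta & forall a b, S0 (a, b) -> delta a = b.
Proof.
move=> g0; pose good S := derivation_graph (S0 `|` S).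
have [|A [gA Amax]] := @Zorn_bigcup _ good.
  move=> F FG Ftot; rewrite /good.
  have [[X0 FX0]|nF] := pselect (exists X, F X); last first.
    rewrite (_ : _ `|` _ = S0) //; apply/setUidPl => c [X FX _].
    by exfalso; apply: nF; exists X.
  have common a b : (S0 `|` \bigcup_(X in F) X) a -> (S0 `|` \bigcup_(X in F) X) b ->
      exists X, [/\ F X, (S0 `|` X) a & (S0 `|` X) b].
    case=> [a0|[X FX Xa]] [b0|[Y FY Yb]].
    - by exists X0; split=> //; left.
    - by exists Y; split=> //; [left|right].
    - by exists X; split=> //; [right|left].
    - have [XY|YX] := Ftot _ _ FX FY.
      + by exists Y; split=> //; right=> //; apply: XY.
      + by exists X; split=> //; right=> //; apply: YX.
  have up X : F X -> (S0 `|` X) `<=` S0 `|` \bigcup_(X in F) X.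
    by move=> FX c [|Xc]; [left | right; exists X].
  split.
  - by left; case: g0.
  - move=> a b /common h /h [X [FX Xa Xb]]; apply: (up X FX).
    by have [_ gB _ _] := FG X FX; exact: gB.
  - move=> a b /common h /h [X [FX Xa Xb]]; apply: (up X FX).
    by have [_ _ gM _] := FG X FX; exact: gM.
  - move=> b h; have [X [FX Xb _]] := common _ _ h h.
    by have [_ _ _ gf] := FG X FX; exact: gf.
have tot x : exists b, (S0 `|` A) (x, b).
  have [b hb] := exists_derivative gA x.
  have gB := derivation_graph_adjoin gA hb.
  have sub := @adjoin_subset _ gA x b.
  have := adjoin_gen gA x b.
  have [AB|nAB] := pselect (adjoin (S0 `|` A) x b `<=` S0 `|` A); first by exists b; apply: AB.
  exfalso; apply: (Amax (adjoin (S0 `|` A) x b)).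
    by split; [move=> c Ac; apply: sub; right | move=> h; apply: nAB => c /h; right].
  rewrite /good (_ : _ `|` _ = adjoin (S0 `|` A) x b) //.
  by apply/setUidPr => c c0; apply: sub; left.
have [delta hd] := choice tot.
have fn a b c : (S0 `|` A) (a, b) -> (S0 `|` A) (a, c) -> b = c.
  case: gA => _ gB _ gf h1 h2; have := gB _ _ h1 h2; rewrite /= subrr => /gf/eqP.
  by rewrite subr_eq0 => /eqP.
exists delta; last by move=> a b h; apply: fn (hd a) _; left.
have g := gA; case: gA => g1 gB gM gf; split=> a b; last first.
  have := gM _ _ (hd a) (hd b); rewrite /= => h; rewrite addrC; exact: fn (hd _) h.
have g00 := gB _ _ g1 g1; rewrite /= !subrr in g00.
have := gB _ _ (hd a) (gB _ _ g00 (hd b)); rewrite /= !opprB !subr0 => h.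
exact: fn (hd _) h.
Qed.

(** The derivation [d/dX_i] of the polynomial ring extends to [K]. *)
Lemma exists_dual_derivation (F : fieldType) (iota : {rmorphism F -> K}) r
    (y : 'I_r -> K) (i : 'I_r) :
    (forall Q : {mpoly F[r]}, mmap iota y Q = 0 -> Q = 0) ->
  exists delta, [/\ derivation delta, forall c, delta (iota c) = 0 &
    forall j, delta (y j) = (i == j)%:R].
Proof.
move=> indep.
pose S0 : set (K * K) := [set c | exists Q, c = (mmap iota y Q, mmap iota y Q^`M(i))].
have [|delta der hd] := @extend_derivation S0.
  split.
  - by exists 1; rewrite -mpolyC1 mderivC mmap0 mpolyC1 rmorph1.
  - by move=> _ _ [P ->] [Q ->]; exists (P - Q); rewrite mderivB !mmapB.
  - move=> _ _ [P ->] [Q ->]; exists (P * Q).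
    by rewrite mderivM mmapD !rmorphM /= addrC.
  - by move=> b [Q [/esym/indep -> ->]]; rewrite mderiv0 mmap0.
exists delta; split=> // [c|j]; apply: hd.
  by exists c%:MP; rewrite mmapC mderivC mmap0.
exists 'X_j; rewrite mmapX mmap1U mderivX mnm1E mmapZ.
have [->|ij] := eqVneq i j; last first.
  by rewrite (rmorph0 iota) mul0r.
rewrite (rmorph1 iota) mul1r [X in 'X_[X]](_ : _ = 0%MM) ?mpolyX0 ?rmorph1 //.
by apply/mnmP => k; rewrite mnmBE mnm0E subnn.
Qed.

End Extension.

(** * Zeros and syzygies of binary forms *)

(** The rows of [V] serve as coordinates transverse to the row space of [W]. *)
Lemma complement_rows (K : fieldType) m n (W : 'M[K]_(m, n)) k :
  (\rank W + k = n)%N ->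
  exists V : 'M_(k, n), forall u : 'rV_n, exists c : 'rV_k, (u - c *m V <= W)%MS.
Proof.
move=> rk; have rC : \rank (W^C)%MS = k by apply/eqP; rewrite -(eqn_add2l (\rank W)) mxrank_compl subnKC ?rank_leq_col ?rk.
have [V eV] : exists V : 'M_(k, n), (V == W^C)%MS.
  by case: k / rC {rk}; exists (row_base W^C%MS); apply/eqmxP; exact: eq_row_base.
exists V => u; have : (u <= W + W^C)%MS by rewrite submx_full // addsmx_compl_full.
move=> /sub_addsmxP[[w1 w2] /= ->].
have /submxP[D ->] : (w2 *m W^C%MS <= V)%MS by rewrite (eqmxP eV) submxMl.
by exists D; rewrite addrK submxMl.
Qed.

Section Gradient.
Variables (n : nat) (K : fieldType).
Implicit Types (g : {mpoly K[n]}) (x w u : 'rV[K]_n).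

Definition gradient g x : 'cV[K]_n := \col_i g^`M(i).@[x 0].

Lemma dirderiv_gradient g x w : (dirderiv w g).@[x 0] = (w *m gradient g x) 0 0.
Proof.
by rewrite meval_dirderiv mxE; apply: eq_bigr => i _; rewrite mxE.
Qed.

Lemma dirderiv_submx g x m (W : 'M_(m, n)) u :
  (forall i, (dirderiv (row i W) g).@[x 0] = 0) -> (u <= W)%MS ->
  (dirderiv u g).@[x 0] = 0.
Proof.
move=> hW /submxP[D ->]; rewrite dirderiv_gradient -mulmxA.
rewrite (_ : W *m _ = 0) ?mulmx0 ?mxE //; apply/matrixP => i j.
have := hW i; rewrite dirderiv_gradient -row_mul mxE ord1 => ->.
by rewrite mxE.
Qed.

Definition vanish_on_span g x y := forall s t, g.@[(s *: x + t *: y) 0] = 0.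

Definition indep2 x y := forall s t : K, s *: x + t *: y = 0 -> s = 0 /\ t = 0.

End Gradient.

Section Binary.
Variables (n : nat) (K : closedFieldType).
Hypothesis char0 : forall k, k.+1%:R != 0 :> K.
Implicit Types (g : {mpoly K[n]}) (x w u : 'rV[K]_n).

(** The point at infinity [y] of the line [x + t y] is exchanged with its
    origin. *)
Lemma horner_restr_lineV m g x y t : g \is m.-homog -> t != 0 ->
  (restr_line g x y).[t] = t ^+ m * (restr_line g y x).[t^-1].
Proof.
move=> hg t0; rewrite !horner_restr_line -(meval_dhomogZ _ _ hg).
by rewrite scalerDr scalerA mulfV // scale1r addrC.
Qed.

(** When the restriction to the affine line [x + t y] has no root, it is
    constant, and then the point at infinity [y] is a zero. *)
Lemma binary_zero m g x y : g \is m.-homog -> (0 < m)%N ->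
  exists s t, (s != 0) || (t != 0) /\ g.@[(s *: x + t *: y) 0] = 0.
Proof.
move=> hg m0; have [/closed_rootP[t]|] := boolP (size (restr_line g x y) != 1%N).
  rewrite /root horner_restr_line => /eqP gt; exists 1, t.
  by rewrite oner_eq0 scale1r.
rewrite negbK => /size_poly1P[c c0 ec]; exists 0, 1.
rewrite oner_eq0 orbT; split=> //.
have E : restr_line g y x = c *: 'X^m.
  apply/eqP; rewrite -subr_eq0; apply/eqP; apply: (poly_ext0 char0) => t t0.
  rewrite !hornerE (horner_restr_lineV _ _ hg t0) ec hornerC mulrC.
  by rewrite subrr.
have := horner_restr_line g y x 0; rewrite E hornerZ hornerXn.
rewrite scale0r addr0 add0r scale1r => <-.
by rewrite expr0n eqn0Ngt m0 mulr0.
Qed.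

(** Where the form [c2 s + d2 t] vanishes, so does [a]: otherwise [a] and [b]
    would have a common zero.  As [a] has no other zero, it is a power of that
    form, of exponent at least [2]; after division by the form, [b] vanishes at
    the same point, a contradiction. *)
Lemma binary_syzygy m a b x y c1 d1 c2 d2 :
    (1 < m)%N -> a \is m.-homog -> b \is m.-homog ->
    (forall s t, a.@[(s *: x + t *: y) 0] = 0 -> b.@[(s *: x + t *: y) 0] = 0 ->
      s = 0 /\ t = 0) ->
    (forall s t, a.@[(s *: x + t *: y) 0] * (s * c1 + t * d1) +
      b.@[(s *: x + t *: y) 0] * (s * c2 + t * d2) = 0) ->
  c2 = 0 /\ d2 = 0.
Proof.
move=> m1 ha hb cop syz; apply: contrapT => nz.
have nz' : c2 != 0 \/ d2 != 0.
  have [c0|] := eqVneq c2 0; [right|by left].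
  by apply/eqP => d0; apply: nz.
(* [z] spans the kernel of the linear form [c2 s + d2 t], which is [1] at [z']. *)
pose z := d2 *: x - c2 *: y.
have [s' [t' st']] : exists s' t', s' * c2 + t' * d2 = 1.
  by case: nz' => h; [exists c2^-1, 0|exists 0, d2^-1]; field.
pose z' := s' *: x + t' *: y.
have zE tau : z + tau *: z' = (d2 + tau * s') *: x + (tau * t' - c2) *: y.
  by rewrite /z /z'; apply/rowP => i; rewrite !mxE; ring.
have cop_z tau : a.@[(z + tau *: z') 0] = 0 -> b.@[(z + tau *: z') 0] = 0 -> False.
  rewrite zE => h1 h2; have [e1 e2] := cop _ _ h1 h2.
  have t0 : tau = 0.
    have -> : tau = (d2 + tau * s') * c2 + (tau * t' - c2) * d2.
      by rewrite -[LHS]mulr1 -st'; ring.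
    by rewrite e1 e2 !mul0r addr0.
  move: e1 e2; rewrite t0 !mul0r addr0 add0r => d20 /eqP; rewrite oppr_eq0 => /eqP c0.
  by case: nz'; rewrite ?c0 ?d20 eqxx.
have syz_z tau : a.@[(z + tau *: z') 0] * ((d2 + tau * s') * c1 + (tau * t' - c2) * d1)
    + b.@[(z + tau *: z') 0] * tau = 0.
  rewrite -[RHS](syz (d2 + tau * s') (tau * t' - c2)) -zE; congr (_ + _ * _).
  by rewrite -[LHS]mulr1 -st'; ring.
have az' : a.@[z' 0] != 0.
  apply/eqP => a0; have := syz s' t'; rewrite -/z' a0 mul0r add0r st' mulr1 => b0.
  have [s0 t0] := cop _ _ a0 b0; move: st'; rewrite s0 t0 !mul0r addr0 => /eqP.
  by rewrite eq_sym oner_eq0.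
have az tau : tau != 0 -> a.@[(z + tau *: z') 0] != 0.
  move=> tau0; apply/eqP => a0; have := syz_z tau; rewrite a0 mul0r add0r => /eqP.
  by rewrite mulf_eq0 (negPf tau0) orbF => /eqP; exact: cop_z.
(* So [a] has no zero on the line outside [z], hence is a power. *)
have [c ec] : exists c, restr_line a z' z = c%:P.
  have [/closed_rootP[t]|] := boolP (size (restr_line a z' z) != 1%N); last first.
    by rewrite negbK => /size_poly1P[c _ ->]; exists c.
  rewrite /root; have [->|t0] := eqVneq t 0.
    by rewrite horner_restr_line scale0r addr0 (negPf az').
  rewrite (horner_restr_lineV _ _ ha t0) mulf_eq0 expf_eq0 (negPf t0) andbF /=.
  by rewrite horner_restr_line (negPf (az _ _)) ?invr_eq0.
have Pa t : t != 0 -> a.@[(z + t *: z') 0] = c * t ^+ m.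
  by move=> t0; rewrite -horner_restr_line (horner_restr_lineV _ _ ha t0) ec hornerC mulrC.
have Ea : restr_line a z z' = c *: 'X^m.
  apply/eqP; rewrite -subr_eq0; apply/eqP; apply: (poly_ext0 char0) => t t0.
  by rewrite !hornerE horner_restr_line Pa // subrr.
have Eb : restr_line b z z' = - (c *: 'X^(m.-1) *
    ((d2%:P + 'X * s'%:P) * c1%:P + ('X * t'%:P - c2%:P) * d1%:P)).
  apply/eqP; rewrite -subr_eq0; apply/eqP; apply: (poly_ext0 char0) => t t0.
  rewrite !hornerE horner_restr_line; apply: (mulIf t0); rewrite mul0r.
  rewrite -[RHS](syz_z t) Pa // -[in RHS](prednK (ltnW m1)) exprS.
  by ring.
have m1' : (m.-1 == 0)%N = false by case: (m) m1 => [|[]].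
apply: (cop_z 0); rewrite -horner_restr_line.
  by rewrite Ea !hornerE expr0n; rewrite eqn0Ngt (ltnW m1) mulr0.
by rewrite Eb !hornerE expr0n m1' mulr0 mul0r oppr0.
Qed.

End Binary.

(** * Lines in a smooth hypersurface *)

Section Tangent.
Variables (n : nat) (K : closedFieldType).
Hypothesis char0 : forall k, k.+1%:R != 0 :> K.
Variables (d : nat) (h : {mpoly K[n]}).
Hypothesis hh : h \is d.-homog.
Hypothesis smooth : forall x : 'rV_n, gradient h x = 0 -> x = 0.
Implicit Types (x w u : 'rV[K]_n).

Lemma gradient_eq0 x : (forall u, (dirderiv u h).@[x 0] = 0) -> gradient h x = 0.
Proof.
move=> hx; apply/matrixP => i j; have := hx (delta_mx 0 i).
by rewrite meval_dirderiv_delta !mxE.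
Qed.

Lemma indep2_neq0 x y (s t : K) : indep2 x y -> (s != 0) || (t != 0) ->
  s *: x + t *: y != 0.
Proof.
by move=> xy st; apply: contraL st => /eqP/xy[-> ->]; rewrite eqxx.
Qed.

(** Otherwise a single directional derivative, which as a form of positive degree
    has a zero on the line, would control the whole gradient on the line. *)
Lemma tangent_rank_le k (W : 'M_(k, n)) x y :
    (1 < d)%N -> indep2 x y ->
    (forall i, vanish_on_span (dirderiv (row i W) h) x y) ->
  (\rank W + 2 <= n)%N.
Proof.
move=> d1 xy hW; rewrite leqNgt; apply/negP => rk.
have [w cw] : exists w : 'rV_n, forall u : 'rV_n, exists c, (u - c *: w <= W)%MS.
  have := rank_leq_col W; rewrite leq_eqVlt => /orP[/eqP rn|ltn].
    exists 0 => u; exists 0; rewrite scale0r subr0 submx_full //.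
    by rewrite -col_leq_rank rn.
  have [|V hV] := @complement_rows K k n W 1; first by move: rk ltn; lia.
  exists (row 0 V) => u; have [c hc] := hV u; exists (c 0 0).
  rewrite (_ : c 0 0 *: row 0 V = c *m V) //.
  by apply/rowP => j; rewrite !mxE big_ord1.
have hd : (0 < d.-1)%N by case: (d) d1 => [|[]].
have [s [t [st hz]]] := binary_zero char0 x y (dhomog_dirderiv w hh) hd.
have := indep2_neq0 xy st; rewrite (smooth (x := s *: x + t *: y)) ?eqxx //.
apply: gradient_eq0 => u; have [c hc] := cw u.
rewrite -[u](subrK (c *: w)) meval_dirderivD meval_dirderivZ hz mulr0 addr0.
by apply: dirderiv_submx hc => i; apply: hW.
Qed.

(** The row space of [E] has the largest dimension that [tangent_rank_le]
    allows. *)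
Lemma submx_of_tangent k (E : 'M_(k, n)) x y u :
    (1 < d)%N -> indep2 x y ->
    (forall i, vanish_on_span (dirderiv (row i E) h) x y) -> (\rank E + 2 = n)%N ->
    vanish_on_span (dirderiv u h) x y ->
  (u <= E)%MS.
Proof.
move=> d1 xy hE rk hu.
have /(tangent_rank_le d1 xy) le i : vanish_on_span (dirderiv (row i (col_mx u E)) h) x y.
  by case: (split_ordP i) => j ->; rewrite ?rowKu ?rowKd ?row_id.
have sub : (E <= col_mx u E)%MS by rewrite -addsmxE addsmxSr.
suff : (col_mx u E <= E)%MS by rewrite -addsmxE addsmx_sub => /andP[].
by rewrite -(mxrank_leqif_sup sub) eqn_leq mxrankS //= -(leq_add2r 2) rk.
Qed.

(** The gradient of [h] along the line lies in a pencil, whose two coordinates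
    are binary forms of degree [d.-1 >= 2] without common zero.  A first-order
    deformation [(x', y')] of the line inside [h = 0] is a syzygy with linear
    coefficients between these forms, hence trivial. *)
Lemma deformation_submx k (E : 'M_(k, n)) x y x' y' :
    (2 < d)%N -> indep2 x y ->
    (forall i, vanish_on_span (dirderiv (row i E) h) x y) ->
    (\rank E + 2 = n)%N ->
    (forall s t, (dirderiv (s *: x' + t *: y') h).@[(s *: x + t *: y) 0] = 0) ->
  (x' <= E)%MS /\ (y' <= E)%MS.
Proof.
move=> d2 xy hE rk def; have [V hV] := complement_rows rk.
pose w1 := row 0 V; pose w2 := row 1 V.
have dec u : exists c1 c2, (u - (c1 *: w1 + c2 *: w2) <= E)%MS.
  have [c hc] := hV u; exists (c 0 0), (c 0 1).
  rewrite (_ : c 0 0 *: w1 + c 0 1 *: w2 = c *m V) //; apply/rowP => j.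
  by rewrite !mxE big_ord_recl big_ord1; congr (_ + c 0 _ * V _ _); apply/val_inj.
have hE' u s t : (u <= E)%MS -> (dirderiv u h).@[(s *: x + t *: y) 0] = 0.
  by apply: dirderiv_submx => i; apply: hE.
have ev u c1 c2 (z : 'rV_n) : (u - (c1 *: w1 + c2 *: w2) <= E)%MS ->
    (forall u, (u <= E)%MS -> (dirderiv u h).@[z 0] = 0) ->
    (dirderiv u h).@[z 0] = (dirderiv w1 h).@[z 0] * c1 + (dirderiv w2 h).@[z 0] * c2.
  move=> hu hz; rewrite -[u in LHS](subrK (c1 *: w1 + c2 *: w2)) meval_dirderivD hz //.
  by rewrite add0r meval_dirderivD !meval_dirderivZ mulrC [c2 * _]mulrC.
have [c1 [c2 hc]] := dec x'; have [d1 [e2 he]] := dec y'.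
have cop s t : (dirderiv w1 h).@[(s *: x + t *: y) 0] = 0 ->
    (dirderiv w2 h).@[(s *: x + t *: y) 0] = 0 -> s = 0 /\ t = 0.
  move=> h1 h2; apply: xy; apply: smooth; apply: gradient_eq0 => u.
  have [a1 [a2 ha]] := dec u.
  by rewrite (ev _ _ _ _ ha) ?h1 ?h2 ?mul0r ?addr0 // => u' /hE'.
have syz s t : (dirderiv w1 h).@[(s *: x + t *: y) 0] * (s * c1 + t * d1) +
    (dirderiv w2 h).@[(s *: x + t *: y) 0] * (s * c2 + t * e2) = 0.
  rewrite -(ev (s *: x' + t *: y')) //.
    rewrite (_ : _ - _ = s *: (x' - (c1 *: w1 + c2 *: w2)) +
      t *: (y' - (d1 *: w1 + e2 *: w2))); first by rewrite addmx_sub // scalemx_sub.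
    by apply/rowP => j; rewrite !mxE; ring.
  by move=> u /hE'.
have hd : (1 < d.-1)%N by case: (d) d2 => [|[|[]]].
have h1 := dhomog_dirderiv w1 hh; have h2 := dhomog_dirderiv w2 hh.
have [z1 z2] := binary_syzygy char0 hd h1 h2 cop syz.
have [z3 z4] : c1 = 0 /\ d1 = 0.
  apply: (binary_syzygy char0 hd h2 h1) => s t; first by move=> g1 g2; apply: cop g2 g1.
  by rewrite addrC; apply: syz.
by move: hc he; rewrite z1 z2 z3 z4 !scale0r !addr0 !subr0.
Qed.

End Tangent.

(** * Derivations of the field of coordinates *)

Section Derivation.
Variable K : fieldType.
Hypothesis char0 : forall k, k.+1%:R != 0 :> K.
Variables (theta : K -> K).
Hypothesis der : derivation theta.

Lemma derivationD a b : theta (a + b) = theta a + theta b.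
Proof. by case: der. Qed.
Lemma derivationM a b : theta (a * b) = theta a * b + a * theta b.
Proof. by case: der. Qed.
Lemma derivation0 : theta 0 = 0.
Proof. by apply: (addrI (theta 0)); rewrite -derivationD !addr0. Qed.
Lemma derivation1 : theta 1 = 0.
Proof.
apply: (addrI (theta 1)); rewrite addr0 -[in RHS](mulr1 1) derivationM.
by rewrite mulr1 mul1r.
Qed.
Lemma derivationN a : theta (- a) = - theta a.
Proof. by apply/eqP; rewrite -addr_eq0 -derivationD addNr derivation0. Qed.
Lemma derivationMn a k : theta (a *+ k) = theta a *+ k.
Proof.
by elim: k => [|k IH]; rewrite ?mulr0n ?derivation0 // !mulrS derivationD IH.
Qed.
Lemma derivation_sum I (r : seq I) (G : I -> K) :
  theta (\sum_(i <- r) G i) = \sum_(i <- r) theta (G i).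
Proof. by elim/big_rec2: _ => [|i x y _ <-]; rewrite ?derivation0 ?derivationD. Qed.

Variable n : nat.
Implicit Types (g : {mpoly K[n]}) (x y w : 'rV[K]_n).

Local Notation "x ^dt" := (map_mx theta x) (at level 2).

Lemma meval_derivation g x :
  theta g.@[x 0] = (coefmap theta g).@[x 0] + (dirderiv x^dt g).@[x 0].
Proof.
rewrite (@derivation_mmap _ _ _ _ _ theta theta) ?derivation0 //.
- congr (_ + _); rewrite meval_dirderiv; apply: eq_bigr => i _.
  by rewrite mxE mulrC.
- exact: derivationD.
- exact: derivationM.
- exact: derivationD.
Qed.

Lemma coefmap_dirderiv w g : coefmap theta (dirderiv w g) =
  dirderiv w^dt g + dirderiv w (coefmap theta g).
Proof.
apply/mpolyP => m; rewrite mcoeffD mcoeff_coefmap ?derivation0 // /dirderiv.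
rewrite !raddf_sum derivation_sum -big_split /=; apply: eq_bigr => i _.
rewrite !mcoeffZ !mcoeff_deriv mcoeff_coefmap ?derivation0 // mxE.
by rewrite derivationM derivationMn.
Qed.

Lemma map_derivation_comb (s t : K) x y : (s *: x + t *: y)^dt =
  (theta s *: x + theta t *: y) + (s *: x^dt + t *: y^dt).
Proof. by apply/rowP => i; rewrite !mxE derivationD !derivationM; ring. Qed.

Lemma vanish_on_span_dirderiv g x y s t : vanish_on_span g x y ->
  vanish_on_span (dirderiv (s *: x + t *: y) g) x y.
Proof.
move=> gxy a b; apply: (dirderiv0_of_vanish char0) => c.
have -> : a *: x + b *: y + c *: (s *: x + t *: y) =
    (a + c * s) *: x + (b + c * t) *: y by apply/rowP => i; rewrite !mxE; ring.
exact: gxy.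
Qed.

(** Differentiate [g (s x + t y) = 0]: the terms with the derivatives of [s] and
    [t] vanish, as they are derivatives inside the plane. *)
Lemma vanish_on_span_deformation g x y : vanish_on_span g x y -> vanish_on_span (coefmap theta g) x y ->
  forall s t, (dirderiv (s *: x^dt + t *: y^dt) g).@[(s *: x + t *: y) 0] = 0.
Proof.
move=> g0 g1 s t; have := meval_derivation g (s *: x + t *: y).
rewrite g0 derivation0 g1 add0r map_derivation_comb meval_dirderivD.
by rewrite (vanish_on_span_dirderiv _ _ g0) add0r => <-.
Qed.

(** Differentiation gives the points with [t != 0]; the others follow since the
    restriction to a line is a polynomial in [t]. *)
Lemma vanish_on_span_dirderiv_der g x y : x^dt = 0 ->
  vanish_on_span g x y -> vanish_on_span (coefmap theta g) x y -> vanish_on_span (dirderiv y^dt g) x y.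
Proof.
move=> x0 g0 g1 s.
have nz t : t != 0 -> (dirderiv y^dt g).@[(s *: x + t *: y) 0] = 0.
  move=> t0; have := vanish_on_span_deformation g0 g1 s t.
  by rewrite x0 scaler0 add0r meval_dirderivZ => /eqP; rewrite mulf_eq0 (negPf t0) => /eqP.
have E : restr_line (dirderiv y^dt g) (s *: x) y = 0.
  by apply: (poly_ext0 char0) => t t0; rewrite horner_restr_line nz.
by move=> t; rewrite -horner_restr_line E horner0.
Qed.

Lemma vanish_on_span_coefmap g x y : x^dt = 0 -> y^dt = 0 ->
  vanish_on_span g x y -> vanish_on_span (coefmap theta g) x y.
Proof.
move=> x0 y0 g0 s t; have := meval_derivation g (s *: x + t *: y).
rewrite g0 derivation0 map_derivation_comb x0 y0 !scaler0 !addr0.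
by rewrite (vanish_on_span_dirderiv _ _ g0) addr0 => <-.
Qed.

End Derivation.

(** The sums are included to make the family stable under [coefmap theta], by the
    Leibniz rule, when the row space of [E] is stable under [theta]. *)
Inductive iter_dirderiv (K : fieldType) n m (E : 'M[K]_(m, n)) (h : {mpoly K[n]}) :
    nat -> {mpoly K[n]} -> Prop :=
| IterId : iter_dirderiv E h 0 h
| IterZero k : iter_dirderiv E h k 0
| IterAdd k p q : iter_dirderiv E h k p -> iter_dirderiv E h k q ->
    iter_dirderiv E h k (p + q)
| IterDer k w p : (w <= E)%MS -> iter_dirderiv E h k p ->
    iter_dirderiv E h k.+1 (dirderiv w p).

Section Iter.
Variables (K : fieldType) (n m : nat) (E : 'M[K]_(m, n)) (h : {mpoly K[n]}).

Lemma iter_dirderiv_coefmap theta k p : derivation theta ->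
    coefmap theta h = 0 ->
    (forall w : 'rV_n, (w <= E)%MS -> (map_mx theta w <= E)%MS) ->
  iter_dirderiv E h k p -> iter_dirderiv E h k (coefmap theta p).
Proof.
move=> der h0 hE; elim=> {k p} [|k|k p q _ IHp _ IHq|k w p wE ip IHp].
- by rewrite h0; constructor.
- by rewrite /coefmap msupp0 big_nil; constructor.
- by rewrite coefmapD ?derivation0 //; [constructor | exact: derivationD].
- by rewrite coefmap_dirderiv //; apply: IterAdd; apply: IterDer => //; apply: hE.
Qed.

Lemma iter_dirderiv_iter k w : (w <= E)%MS ->
  iter_dirderiv E h k (iter k (dirderiv w) h).
Proof. by move=> wE; elim: k => [|k IH]; constructor. Qed.

Lemma iter_dirderiv_ind_vanish x y :
    vanish_on_span h x y ->
    (forall k, (forall p, iter_dirderiv E h k p -> vanish_on_span p x y) ->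
      forall p w, iter_dirderiv E h k p -> (w <= E)%MS -> vanish_on_span (dirderiv w p) x y) ->
  forall k p, iter_dirderiv E h k p -> vanish_on_span p x y.
Proof.
move=> h0 step; elim=> [|k IH] p.
  move e0: 0%N => k ip.
  elim: ip e0 => {k p} [_ //|k _|k p q _ IHp _ IHq k0|//] s t.
    by rewrite meval0.
  by rewrite mevalD IHp ?IHq ?addr0.
move ek: k.+1 => k' ip.
elim: ip ek => {k' p} [//|k' _|k' p q _ IHp _ IHq ek|k' w p wE ip _ [ek]].
- by move=> s t; rewrite meval0.
- by move=> s t; rewrite mevalD IHp ?IHq ?addr0.
- by rewrite -ek in ip; exact: (step k IH).
Qed.

End Iter.

(** * The Pluecker map and derivations over the base field *)

Section Plucker.
Variables (K : fieldType) (N : nat).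
Implicit Types (u v w : 'rV[K]_N.+1).

Lemma pluckerDr u v w : plucker u (v + w) = plucker u v + plucker u w.
Proof. by rewrite /plucker -raddfD /= mulmxDr [(v + w)^T]linearD /= mulmxDl opprD addrACA. Qed.

Lemma pluckerZr c u v : plucker u (c *: v) = c *: plucker u v.
Proof.
by rewrite /plucker -linearZ /= -scalemxAr [(c *: v)^T]linearZ /= -scalemxAl scalerBr.
Qed.

Lemma plucker_antisym u v : plucker v u = - plucker u v.
Proof. by rewrite /plucker -[RHS]raddfN /= opprB. Qed.

Lemma pluckerDl u v w : plucker (v + w) u = plucker v u + plucker w u.
Proof. by rewrite plucker_antisym pluckerDr opprD -!plucker_antisym. Qed.

Lemma pluckerZl c u v : plucker (c *: u) v = c *: plucker u v.
Proof. by rewrite plucker_antisym pluckerZr -scalerN -plucker_antisym. Qed.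

Lemma plucker_id u : plucker u u = 0.
Proof. by rewrite /plucker subrr raddf0. Qed.

Lemma plucker_suml (I : finType) (c : I -> K) (G : I -> 'rV_N.+1) u :
  plucker u (\sum_i c i *: G i) = \sum_i c i *: plucker u (G i).
Proof.
elim/big_rec2: _ => [|i x y _ <-]; last by rewrite pluckerDr pluckerZr.
by rewrite -(scale0r 0) pluckerZr scale0r.
Qed.

Lemma map_plucker theta u v : derivation theta ->
  map_mx theta (plucker u v) =
    plucker (map_mx theta u) v + plucker u (map_mx theta v).
Proof.
move=> der; rewrite /plucker -raddfD /=.
rewrite -[LHS]vec_mxK; congr mxvec; apply/matrixP => i j.
rewrite !mxE mxvecE !mxE !big_ord1 !mxE derivationD // derivationN //.
by rewrite !(derivationM der); ring.
Qed.

End Plucker.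

Definition derivation_over (F K : fieldType) (iota : F -> K) (delta : K -> K) :=
  derivation delta /\ forall c, delta (iota c) = 0.

Lemma coefmap_map_mpoly (F K : fieldType) (iota : {rmorphism F -> K}) n
    (g : {mpoly F[n]}) delta :
  derivation_over iota delta -> coefmap delta (map_mpoly iota g) = 0.
Proof.
move=> [der dF]; apply/mpolyP => m.
by rewrite mcoeff_coefmap ?derivation0 // mcoeff_map_mpoly dF mcoeff0.
Qed.

Lemma dhomog_map_mpoly (F K : fieldType) (iota : {rmorphism F -> K}) n d
    (g : {mpoly F[n]}) : g \is d.-homog -> map_mpoly iota g \is d.-homog.
Proof.
move=> /dhomogP hg; apply/dhomogP => m; rewrite mcoeff_msupp mcoeff_map_mpoly.
by rewrite fmorph_eq0 -mcoeff_msupp => /hg.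
Qed.

Lemma mderiv_map_mpoly (F K : fieldType) (iota : {rmorphism F -> K}) n i
    (g : {mpoly F[n]}) : (map_mpoly iota g)^`M(i) = map_mpoly iota g^`M(i).
Proof.
apply/mpolyP => m; rewrite mcoeff_map_mpoly !mcoeff_deriv mcoeff_map_mpoly.
by rewrite raddfMn.
Qed.

Lemma meval_map_mpoly (F K : fieldType) (iota : {rmorphism F -> K}) n
    (g : {mpoly F[n]}) (x : 'I_n -> K) : (map_mpoly iota g).@[x] = mmap iota x g.
Proof.
rewrite mevalE /mmap (perm_big _ (msupp_map_mpoly _ _)) //=; last exact: fmorph_inj.
by apply: eq_bigr => m _; rewrite mcoeff_map_mpoly.
Qed.

Section Commutator.
Variables (F K : fieldType) (iota : F -> K) (delta eta : K -> K).
Hypothesis hd : derivation_over iota delta.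
Hypothesis he : derivation_over iota eta.

Lemma derivation_over_bracket :
  derivation_over iota (fun x => delta (eta x) - eta (delta x)).
Proof.
case: hd he => dd d0 [de e0]; split=> [|c]; last first.
  by rewrite e0 d0 (derivation0 dd) (derivation0 de) subr0.
split=> a b; first by rewrite !(derivationD de, derivationD dd); ring.
by rewrite !(derivationM de, derivationM dd, derivationD de, derivationD dd); ring.
Qed.

Lemma derivation_over_comb a b :
  derivation_over iota (fun x => a * delta x + b * eta x).
Proof.
case: hd he => dd d0 [de e0]; split=> [|c]; last by rewrite e0 d0 !mulr0 addr0.
by split=> x y; rewrite !(derivationM de, derivationM dd, derivationD de, derivationD dd); ring.
Qed.

End Commutator.

(** A relation of least degree has a nonzero gradient at [q], and by Euler's
    identity the gradient has a nonzero entry for one of the first two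
    coordinates.  Derivations over the base field move [q] in the kernel of the
    gradient, and fix its last coordinate. *)
Lemma derivation_plane_curve (F K : fieldType) (iota : {rmorphism F -> K})
    (char0 : forall k, k.+1%:R != 0 :> K) (q : 'rV[K]_3) m (Q : {mpoly F[3]}) :
    Q != 0 -> Q \is m.-homog -> q 0 2 = 1 -> (map_mpoly iota Q).@[q 0] = 0 ->
  forall delta eta, derivation_over iota delta -> derivation_over iota eta ->
  delta (q 0 0) * eta (q 0 1) = delta (q 0 1) * eta (q 0 0).
Proof.
move=> nzQ hQ q2 Qq.
pose rel m := `[< exists Q, [/\ Q != 0, Q \is m.-homog & (map_mpoly iota Q).@[q 0] = 0] >].
have ex : exists m, rel m by exists m; apply/asboolP; exists Q.
have [{nzQ hQ Qq}k /asboolP[{}Q [nzQ hQ Qq]] kmin] := ex_minnP ex.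
set QK := map_mpoly iota Q in Qq *.
have hQK : QK \is k.-homog by apply: dhomog_map_mpoly.
have charF j : j.+1%:R != 0 :> F.
  by rewrite -(fmorph_eq0 iota) rmorph_nat.
have [i nz] : exists i : 'I_3, QK^`M(i).@[q 0] != 0.
  have nzm := mlead_supp nzQ.
  have [i mi] : exists i, mlead Q i != 0%N.
    apply: contrapT => nex; have m0 : mlead Q = 0%MM.
      apply/mnmP => i; rewrite mnm0E; apply/eqP; apply: contraT => mi.
      by exfalso; apply: nex; exists i.
    have k0 : k = 0%N by have /dhomogP/(_ _ nzm) := hQ; rewrite m0 /= mdeg0.
    have QC : Q = (Q@_0)%:MP.
      apply/mpolyP => l; rewrite mcoeffC; case: eqP => [->|]; rewrite ?mulr1 ?mulr0 //.
      move/eqP => l0; apply: (dhomog_nemf_coeff hQ).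
      by rewrite k0 /= mdeg_eq0.
    move: Qq; rewrite /QK QC map_mpolyC ?rmorph0 // mevalC => /eqP.
    by rewrite fmorph_eq0 => /eqP e; move: nzQ; rewrite QC e mpolyC0 eqxx.
  exists i; apply/eqP => e.
  have nzd : Q^`M(i) != 0.
    apply/eqP => /mpolyP/(_ (mlead Q - U_(i))%MM); rewrite mcoeff_deriv mcoeff0.
    rewrite submK ?lep1mP // -mulr_natr => /eqP; rewrite mulf_eq0 (negPf (charF _)) orbF.
    by rewrite mleadc_eq0 (negPf nzQ).
  have /kmin : rel k.-1.
    apply/asboolP; exists Q^`M(i); split=> //; first exact: dhomog_mderiv.
    by rewrite -mderiv_map_mpoly.
  have kgt : (0 < k)%N.
    have /dhomogP/(_ _ nzm)/= <- := hQ.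
    by rewrite lt0n mdeg_eq0; apply: contra mi => /eqP ->; rewrite mnm0E.
  by rewrite -ltnS prednK // ltnn.
pose G i := QK^`M(i).@[q 0].
have sum3 (c : 'I_3 -> K) : \sum_i c i = c 0 + c 1 + c 2.
  rewrite !big_ord_recl big_ord0 addr0 addrA.
  by congr (_ + c _ + c _); apply/val_inj.
have eul : q 0 0 * G 0 + q 0 1 * G 1 + G 2 = 0.
  have := euler char0 (q) hQK; rewrite Qq mulr0 meval_dirderiv sum3 q2 mul1r.
  exact.
have nzG : (G 0 != 0) || (G 1 != 0).
  apply: contraT; rewrite negb_or !negbK => /andP[/eqP G0 /eqP G1].
  have G2 : G 2 = 0 by rewrite -eul G0 G1 !mulr0 !add0r.
  move: nz; rewrite -/(G i) (_ : G i = 0) ?eqxx //.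
  by case: i => -[|[|[|//]]] lti; [rewrite -[RHS]G0 | rewrite -[RHS]G1 |
    rewrite -[RHS]G2]; congr G; apply/val_inj.
have tang delta : derivation_over iota delta ->
    delta (q 0 0) * G 0 + delta (q 0 1) * G 1 = 0.
  move=> hd; have [der _] := hd; have := meval_derivation der QK q.
  rewrite Qq derivation0 // coefmap_map_mpoly // meval0 add0r meval_dirderiv sum3.
  by rewrite !mxE q2 derivation1 // mul0r addr0 => ->.
move=> delta eta /tang r1 /tang r2.
case/orP: nzG => h; apply: (mulIf h); apply/eqP; rewrite -subr_eq0; apply/eqP.
  have -> : delta (q 0 0) * eta (q 0 1) * G 0 - delta (q 0 1) * eta (q 0 0) * G 0 =
    eta (q 0 1) * (delta (q 0 0) * G 0 + delta (q 0 1) * G 1) -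
    delta (q 0 1) * (eta (q 0 0) * G 0 + eta (q 0 1) * G 1) by ring.
  by rewrite r1 r2 !mulr0 subr0.
have -> : delta (q 0 0) * eta (q 0 1) * G 1 - delta (q 0 1) * eta (q 0 0) * G 1 =
    delta (q 0 0) * (eta (q 0 0) * G 0 + eta (q 0 1) * G 1) -
    eta (q 0 0) * (delta (q 0 0) * G 0 + delta (q 0 1) * G 1) by ring.
by rewrite r1 r2 !mulr0 subr0.
Qed.

(** * A generic line of the family *)

(** The line spanned by [p] and [v] is a generic member of a family of lines in
    [h = 0], and [p] is its point on a curve; [prop] expresses that the curve
    has dimension one, and [indep] that the family has dimension [r]. *)
Section Core.
Variables (F : fieldType) (K : closedFieldType) (iota : {rmorphism F -> K}).
Hypothesis char0 : forall k, k.+1%:R != 0 :> K.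
Variables (r d : nat) (f : {mpoly F[r.+3]}).
Hypothesis hd : (3 <= d)%N.
Hypothesis hf : f \is d.-homog.
Let h := map_mpoly iota f.
Hypothesis smooth : forall x : 'rV_r.+3, gradient h x = 0 -> x = 0.
Hypothesis common_zero : forall m k (a b : {mpoly K[r.+3]}) (E : 'M_(k, r.+3)),
  (2 < k)%N -> (0 < m)%N -> a \is m.-homog -> b \is m.-homog ->
  exists y : 'rV_k, [/\ y != 0, a.@[(y *m E) 0] = 0 & b.@[(y *m E) 0] = 0].
Variables (p v : 'rV[K]_r.+3) (j0 : 'I_r.+3).
Hypothesis pj0 : p 0 j0 = 1.
Hypothesis line_in_h : vanish_on_span h p v.
Hypothesis prop : forall delta eta, derivation_over iota delta ->
  derivation_over iota eta ->
  forall a b, delta (p 0 a) * eta (p 0 b) = delta (p 0 b) * eta (p 0 a).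
Variables (e : 'I_r.+1 -> nat) (g : 'I_r.+1 -> {mpoly F[r.+3 * r.+3]}).
Hypothesis hg : forall i, g i \is (e i).-homog.
Let P := plucker p v.
Let G i := (map_mpoly iota (g i)).@[P 0].
Hypothesis indep : forall Q : {mpoly F[r.+1]}, mmap iota G Q = 0 -> Q = 0.

Local Notation "x ^dt theta" := (map_mx theta x) (at level 2, theta at level 1).

Let hh : h \is d.-homog. Proof. exact: dhomog_map_mpoly. Qed.
Let d1 : (1 < d)%N. Proof. exact: ltnW. Qed.
Let coef_h delta : derivation_over iota delta -> coefmap delta h = 0.
Proof. exact: coefmap_map_mpoly. Qed.

Lemma der_G delta i : derivation_over iota delta ->
  delta (G i) = (dirderiv (P ^dt delta) (map_mpoly iota (g i))).@[P 0].
Proof.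
move=> dF; have [der _] := dF.
by rewrite /G (meval_derivation der) coefmap_map_mpoly // meval0 add0r.
Qed.

Lemma exists_delta : exists delta : 'I_r.+1 -> K -> K,
  forall i, derivation_over iota (delta i) /\
    forall j, delta i (G j) = (i == j)%:R.
Proof.
have ex (i : 'I_r.+1) : exists dl, derivation_over iota dl /\
    forall j, dl (G j) = (i == j)%:R.
  by have [dl [h1 h2 h3]] := exists_dual_derivation char0 i indep; exists dl.
have [delta hdl] := choice ex; by exists delta.
Qed.

Lemma P_neq0 : P != 0.
Proof.
apply/eqP => P0; have [delta hdl] := exists_delta.
have [dF dG] := hdl 0; have [der _] := dF.
have := dG 0; rewrite eqxx der_G // P0.
rewrite (_ : _ ^dt _ = 0) ?dirderiv_gradient ?mul0mx ?mxE.
  by move=> /eqP; rewrite eq_sym oner_eq0.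
by apply/rowP => i; rewrite !mxE derivation0.
Qed.

Lemma indep_pv : indep2 p v.
Proof.
move=> s t st; have t0 : t = 0.
  apply: contraTeq P_neq0 => t0; rewrite negbK; apply/eqP.
  have : plucker p (s *: p + t *: v) = t *: P.
    by rewrite pluckerDr !pluckerZr plucker_id scaler0 add0r.
  rewrite st -(scale0r 0) pluckerZr scale0r => /esym/eqP.
  by rewrite scaler_eq0 (negPf t0) => /eqP.
split=> //; move: st; rewrite t0 scale0r addr0 => /rowP/(_ j0).
by rewrite !mxE pj0 mulr1.
Qed.

Lemma tangent_p i : vanish_on_span (dirderiv (row i p) h) p v.
Proof.
rewrite row_id -[p in dirderiv p]addr0 -(scale0r v) -[p in dirderiv (p + _)]scale1r.
exact: (vanish_on_span_dirderiv char0).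
Qed.

Lemma tangent_v : vanish_on_span (dirderiv v h) p v.
Proof.
rewrite -[v in dirderiv v]add0r -(scale0r p) -[v in dirderiv (_ + v)]scale1r.
exact: (vanish_on_span_dirderiv char0).
Qed.

Lemma vanish_on_span_0 x y : vanish_on_span (0 : {mpoly K[r.+3]}) x y.
Proof. by move=> s t; rewrite meval0. Qed.

(** Derivations fixing [p] deform the line through [p]; if they are dual to
    some of the coordinates [G i], then these deformations are independent. *)
Section Fixing.
Variables (k : nat) (theta : 'I_k -> K -> K) (sigma : 'I_k -> 'I_r.+1).
Hypothesis thetaF : forall i, derivation_over iota (theta i).
Hypothesis theta_p : forall i, p ^dt (theta i) = 0.
Hypothesis theta_G : forall i j, theta i (G (sigma j)) = (i == j)%:R.

Definition fixing_deform : 'M_(1 + k, r.+3) :=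
  col_mx p (\matrix_(i < k) v ^dt (theta i)).

(** A combination of the derivations that moves [v] only along [p] fixes the
    Pluecker coordinates of the line. *)
Lemma rank_fixing_deform : \rank fixing_deform = k.+1.
Proof.
have : row_free fixing_deform; last by rewrite /row_free => /eqP.
rewrite -kermx_eq0; apply/rowV0P => D /sub_kermxP.
rewrite -[D]hsubmxK /fixing_deform mul_row_col; set a := lsubmx D; set b := rsubmx D.
have -> : a *m p = a 0 0 *: p by rewrite [a in LHS]mx11_scalar mul_scalar_mx.
have -> : b *m \matrix_i v ^dt (theta i) = \sum_i b 0 i *: v ^dt (theta i).
  by rewrite mulmx_sum_row; apply: eq_bigr => i _; rewrite rowK.
move=> ab0; have b0 : b = 0.
  apply/rowP => j; rewrite [RHS]mxE.
  have : \sum_i b 0 i *: P ^dt (theta i) = 0.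
    have : plucker p (\sum_i b 0 i *: v ^dt (theta i)) = 0.
      have : plucker p (a 0 0 *: p + \sum_i b 0 i *: v ^dt (theta i)) = 0.
        by rewrite ab0 -(scale0r 0) pluckerZr scale0r.
      by rewrite pluckerDr pluckerZr plucker_id scaler0 add0r.
    rewrite plucker_suml => e0; rewrite -[RHS]e0; apply: eq_bigr => i _.
    have [der _] := thetaF i; rewrite /P map_plucker // theta_p.
    by rewrite -(scale0r 0) pluckerZl scale0r add0r.
  move=> /(congr1 (fun w => (dirderiv w (map_mpoly iota (g (sigma j)))).@[P 0])).
  rewrite [RHS]dirderiv_gradient mul0mx mxE.
  rewrite dirderiv_gradient mulmx_suml summxE (bigD1 j) //= big1 => [|i ij].
    rewrite -scalemxAl mxE -dirderiv_gradient -der_G // theta_G eqxx mulr1 addr0.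
    exact.
  by rewrite -scalemxAl mxE -dirderiv_gradient -der_G // theta_G (negPf ij) mulr0.
move: ab0; rewrite b0 big1 => [|i _]; last by rewrite mxE scale0r.
rewrite addr0 => /rowP/(_ j0); rewrite mxE pj0 mulr1 [RHS]mxE => a00.
rewrite (_ : a = 0) ?row_mx0 //.
by apply/rowP => i; rewrite ord1 [RHS]mxE.
Qed.

Lemma tangent_fixing i : vanish_on_span (dirderiv (row i fixing_deform) h) p v.
Proof.
case: (split_ordP i) => j ->; rewrite ?rowKu ?rowKd; first exact: tangent_p.
rewrite rowK; have [der _] := thetaF j.
by apply: (vanish_on_span_dirderiv_der char0 der) => //; rewrite coef_h //; exact: vanish_on_span_0.
Qed.

End Fixing.

(** If all the derivations fixed [p], they would give more tangent directions
    than [tangent_rank_le] allows. *)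
Lemma exists_moving (delta : 'I_r.+1 -> K -> K) :
  (forall i, derivation_over iota (delta i) /\ forall j, delta i (G j) = (i == j)%:R) ->
  exists i a, delta i (p 0 a) != 0.
Proof.
move=> hdl; apply: contrapT => nex.
have fix_p i : p ^dt (delta i) = 0.
  apply/rowP => a; rewrite !mxE; apply/eqP; apply: contraT => nz.
  by exfalso; apply: nex; exists i, a.
have dF i : derivation_over iota (delta i) by case: (hdl i).
have dG i j : delta i (G (id j)) = (i == j)%:R by case: (hdl i).
have := tangent_rank_le char0 hh smooth d1 indep_pv (tangent_fixing dF fix_p).
by rewrite (rank_fixing_deform dF fix_p dG); lia.
Qed.

(** The lines through [p] sweep out a cone, with tangent space [E] along the
    generic line.  The derivation [dstar] moves [p] along the curve, in the
    direction [p']. *)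
Section Cone.
Variables (theta : 'I_r -> K -> K) (sigma : 'I_r -> 'I_r.+1).
Hypothesis thetaF : forall i, derivation_over iota (theta i).
Hypothesis theta_p : forall i, p ^dt (theta i) = 0.
Hypothesis theta_G : forall i j, theta i (G (sigma j)) = (i == j)%:R.
Variables (dstar : K -> K) (a : 'I_r.+3).
Hypothesis dstarF : derivation_over iota dstar.
Hypothesis dstar_a : dstar (p 0 a) = 1.

Let E := fixing_deform theta.
Let rkE : (\rank E + 2 = r.+3)%N.
Proof. by rewrite (rank_fixing_deform thetaF theta_p theta_G) addn2. Qed.
Let tanE i : vanish_on_span (dirderiv (row i E) h) p v.
Proof. exact: tangent_fixing. Qed.
Let p' := p ^dt dstar.

Lemma v_in_E : (v <= E)%MS.
Proof.
exact: (submx_of_tangent char0 hh smooth d1 indep_pv tanE rkE tangent_v).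
Qed.

Lemma p_in_E : (p <= E)%MS.
Proof. by rewrite /E /fixing_deform -addsmxE addsmxSl. Qed.

Lemma der_in_E delta : derivation_over iota delta ->
  (p ^dt delta <= E)%MS /\ (v ^dt delta <= E)%MS.
Proof.
move=> dF; have [der _] := dF.
apply: (deformation_submx char0 hh smooth hd indep_pv tanE rkE).
by apply: (vanish_on_span_deformation char0 der line_in_h); rewrite coef_h //; exact: vanish_on_span_0.
Qed.

(** The bracket of [theta i] and [dstar] moves [p] in a direction proportional to
    [p'], but it fixes the coordinate [a] along which [p'] is [1]. *)
Lemma theta_p' i : p' ^dt (theta i) = 0.
Proof.
have [ds _] := dstarF; have [dt _] := thetaF i.
have tp b : theta i (p 0 b) = 0.
  by have /rowP/(_ b) := theta_p i; rewrite !mxE.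
apply/rowP => b; rewrite !mxE.
have := prop (derivation_over_bracket (thetaF i) dstarF) dstarF a b.
rewrite /= dstar_a !tp (derivation0 ds) (derivation1 dt) !subr0 mul0r mulr1.
exact: esym.
Qed.

Lemma indep_pp' : indep2 p p'.
Proof.
have [ds _] := dstarF => s t st.
have s0 : s = 0.
  move/rowP/(_ j0): st; rewrite /p' !mxE pj0 (derivation1 ds) mulr0 addr0 mulr1.
  exact.
split=> //; move/rowP/(_ a): st; rewrite /p' s0 scale0r add0r !mxE dstar_a mulr1.
exact.
Qed.

(** The cone is also a cone with vertex any point of the line [p p']: since [p']
    is fixed by the derivations [theta i] and lies in [E], every derivative of
    [h] in the direction [p'] vanishes on the generic line. *)
Lemma plane_in_h s t u : h.@[(s *: p + t *: v + u *: p') 0] = 0.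
Proof.
have p'E : (p' <= E)%MS by case: (der_in_E dstarF).
have cf i k : coefmap (theta i) (iter k (dirderiv p') h) = 0.
  have [der _] := thetaF i.
  elim: k => [|k IH] /=; first by rewrite coef_h.
  rewrite coefmap_dirderiv // theta_p' IH dirderiv0 addr0.
  by rewrite /dirderiv big1 // => b _; rewrite mxE scale0r.
apply: (taylor char0) => k; move: s t; rewrite -/(vanish_on_span _ _ _).
elim: k => [|k IH] //= s t; apply: dirderiv_submx p'E => i.
case: (split_ordP i) => j ->; rewrite ?rowKu ?rowKd.
  rewrite row_id -[p in dirderiv p]addr0 -(scale0r v) -[p in dirderiv (p + _)]scale1r.
  exact: (vanish_on_span_dirderiv char0).
rewrite rowK; have [der _] := thetaF j.
by apply: (vanish_on_span_dirderiv_der char0 der) => //; rewrite cf; exact: vanish_on_span_0.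
Qed.

(** So the hyperplanes tangent to [h = 0] along the line [p p'] contain [v] and
    all its derivatives; they meet exactly in [E]. *)
Lemma tangent_along_vertex (w : 'rV_r.+3) :
  vanish_on_span (dirderiv w h) p p' <-> (w <= E)%MS.
Proof.
pose Y w := vanish_on_span (dirderiv w h) p p'.
have pl : vanish_on_span h p p'.
  by move=> s u; have := plane_in_h s 0 u; rewrite scale0r addr0.
have Yp : Y p.
  rewrite /Y -[p in dirderiv p]addr0 -(scale0r p') -[p in dirderiv (p + _)]scale1r.
  exact: (vanish_on_span_dirderiv char0).
have Yv : Y v.
  move=> s u; apply: (dirderiv0_of_vanish char0) => t.
  by have := plane_in_h s t u; rewrite addrAC.
have Yt i u : Y u -> Y (u ^dt (theta i)).
  have [der _] := thetaF i => Yu.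
  have := vanish_on_span_coefmap char0 der (theta_p i) (theta_p' i) Yu.
  by rewrite coefmap_dirderiv // coef_h // dirderiv0 addr0.
have YE i : Y (row i E).
  by case: (split_ordP i) => j ->; rewrite ?rowKu ?rowKd ?row_id ?rowK //; apply: Yt.
split; first exact: (submx_of_tangent char0 hh smooth d1 indep_pp' YE rkE).
by move=> wE s u; apply: dirderiv_submx wE => i; apply: YE.
Qed.

(** The line [p p'] is fixed by [theta i], hence so is the intersection [E] of
    the tangent hyperplanes along it. *)
Lemma E_stable i (w : 'rV_r.+3) : (w <= E)%MS -> (w ^dt (theta i) <= E)%MS.
Proof.
have [der _] := thetaF i.
rewrite -!tangent_along_vertex => Yw.
have := vanish_on_span_coefmap char0 der (theta_p i) (theta_p' i) Yw.
by rewrite coefmap_dirderiv // coef_h // dirderiv0 addr0.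
Qed.

(** All iterated derivatives of [h] along [E] vanish on the generic line, by
    induction on their order: the derivations [theta i] preserve the family of
    derivatives of a given order, and they move [v] in directions that span
    [E] together with [p]. *)
Lemma E_in_h (w : 'rV_r.+3) : (w <= E)%MS -> h.@[w 0] = 0.
Proof.
move=> wE; have wvE : (w - v <= E)%MS by rewrite addmx_sub // eqmx_opp v_in_E.
have -> : w = v + 1 *: (w - v) by rewrite scale1r addrC subrK.
apply: (taylor char0) => k.
suff : vanish_on_span (iter k (dirderiv (w - v)) h) p v.
  by move=> /(_ 0 1); rewrite scale0r add0r scale1r.
apply: (iter_dirderiv_ind_vanish _ _ (iter_dirderiv_iter h k wvE)) => // {}k IH q u iq uE s t.
apply: dirderiv_submx uE => i.
case: (split_ordP i) => j ->; rewrite ?rowKu ?rowKd.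
  rewrite row_id -[p in dirderiv p]addr0 -(scale0r v) -[p in dirderiv (p + _)]scale1r.
  by apply: (vanish_on_span_dirderiv char0); apply: IH.
rewrite rowK; have [der _] := thetaF j.
apply: (vanish_on_span_dirderiv_der char0 der) => //; first exact: IH.
apply: IH; apply: iter_dirderiv_coefmap => //; first exact: coef_h.
by move=> *; apply: E_stable.
Qed.

(** The linear space [E] has projective dimension at least [2], and on it the
    gradient of [h] has only two coordinates, which have a common zero. *)
Lemma cone_absurd : (2 <= r)%N -> False.
Proof.
move=> r2; have [V hV] := complement_rows rkE.
pose w1 := row 0 V; pose w2 := row 1 V.
have hd1 : (0 < d.-1)%N by case: (d) d1 => [|[]].
have [|y [y0 hy1 hy2]] := @common_zero d.-1 (1 + r) (dirderiv w1 h) (dirderiv w2 h) E _ hd1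
  (dhomog_dirderiv w1 hh) (dhomog_dirderiv w2 hh); first by [].
have /row_freeP[B EB] : row_free E.
  by rewrite /row_free (rank_fixing_deform thetaF theta_p theta_G).
suff yE0 : y *m E = 0.
  by move: y0; rewrite -[y]mulmx1 -EB mulmxA yE0 mul0mx eqxx.
apply: smooth; apply: gradient_eq0 => u.
have [c hc] := hV u.
have -> : u = (u - c *m V) + (c 0 0 *: w1 + c 0 1 *: w2).
  rewrite (_ : c 0 0 *: w1 + c 0 1 *: w2 = c *m V) ?subrK //; apply/rowP => j.
  by rewrite !mxE big_ord_recl big_ord1; congr (_ + c 0 _ * V _ _); apply/val_inj.
rewrite meval_dirderivD [X in _ + X]meval_dirderivD !meval_dirderivZ hy1 hy2 !mulr0 !addr0.
apply: (dirderiv0_of_vanish char0) => t; apply: E_in_h.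
by rewrite addmx_sub ?scalemx_sub // submxMl.
Qed.

End Cone.

(** Correct the derivations by multiples of one that moves [p], so that the
    others fix [p]. *)
Theorem core_absurd : False.
Proof.
have [delta hdl] := exists_delta.
have dF i : derivation_over iota (delta i) by case: (hdl i).
have dG i j : delta i (G j) = (i == j)%:R by case: (hdl i).
have [i0 [a nza]] := exists_moving hdl.
pose c := (delta i0 (p 0 a))^-1.
pose dstar x := c * delta i0 x + 0 * delta i0 x.
have dsF : derivation_over iota dstar by apply: derivation_over_comb.
have ds_a : dstar (p 0 a) = 1 by rewrite /dstar mul0r addr0 /c mulVf.
pose sigma (i : 'I_r) := lift i0 i.
pose theta i x := 1 * delta (sigma i) x + (- delta (sigma i) (p 0 a)) * dstar x.
have tF i : derivation_over iota (theta i) by apply: derivation_over_comb.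
have tp i : p ^dt (theta i) = 0.
  apply/rowP => b; rewrite !mxE /theta mul1r mulNr.
  by rewrite -(prop (dF _) dsF) ds_a mulr1 subrr.
have tG i j : theta i (G (sigma j)) = (i == j)%:R.
  rewrite /theta /dstar !dG (inj_eq lift_inj) (negPf (neq_lift _ _)).
  by rewrite !mulr0 addr0 mulr0 addr0 mul1r.
have [r2|r2] := leqP 2 r; first exact: (cone_absurd tF tp tG dsF ds_a r2).
(* For curves and surfaces the tangent space [E] is the line itself, so that no
   derivation moves the line. *)
set E := fixing_deform theta.
have rkE : \rank E = r.+1 by apply: rank_fixing_deform tG.
have sub : (col_mx p v <= E)%MS.
  rewrite -addsmxE addsmx_sub p_in_E //=; exact: v_in_E tG.
have rk2 : \rank (col_mx p v) = 2.
  have : row_free (col_mx p v); last by rewrite /row_free => /eqP.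
  rewrite -kermx_eq0; apply/rowV0P => D /sub_kermxP.
  rewrite -[D]hsubmxK mul_row_col [lsubmx D]mx11_scalar [rsubmx D]mx11_scalar.
  rewrite !mul_scalar_mx => /indep_pv[-> ->].
  by apply/rowP => i; case: (split_ordP i) => j ->; rewrite ?row_mxEl ?row_mxEr !ord1 !mxE.
have r1 : r = 1%N by have := mxrankS sub; rewrite rk2 rkE; lia.
have Esub : (E <= col_mx p v)%MS.
  by rewrite -(mxrank_leqif_sup sub) rk2 rkE r1.
have comb x : (x <= E)%MS -> exists s t, x = s *: p + t *: v.
  move=> /submx_trans/(_ Esub)/submxP[D ->]; exists (lsubmx D 0 0), (rsubmx D 0 0).
  by rewrite -[D in LHS]hsubmxK mul_row_col [lsubmx D in LHS]mx11_scalar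
    [rsubmx D in LHS]mx11_scalar !mul_scalar_mx.
have dP i : exists c, forall j, delta i (G j) = c * ((e j)%:R * G j).
  have [] := der_in_E tF tp tG (dF i).
  move=> /comb[s [t e1]] /comb[s' [t' e2]]; exists (s + t') => j.
  have [der _] := dF i.
  rewrite der_G // /P map_plucker // e1 e2 pluckerDl pluckerDr !pluckerZl !pluckerZr.
  rewrite !plucker_id !scaler0 addr0 add0r -scalerDl meval_dirderivZ.
  by rewrite (euler char0 _ (dhomog_map_mpoly iota (hg j))).
have lt1 : (1 < r.+1)%N by rewrite r1.
pose i1 : 'I_r.+1 := Ordinal lt1.
have [c0 h0] := dP 0; have [c1 h1] := dP i1.
have := h0 i1; rewrite dG => /esym/eqP; rewrite mulf_eq0 => /orP[/eqP c00|/eqP z].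
  by have := h0 0; rewrite dG c00 mul0r => /eqP; rewrite oner_eq0.
by have := h1 i1; rewrite dG z mulr0 eqxx => /eqP; rewrite oner_eq0.
Qed.

End Core.

(** * Noetherianity of polynomial rings *)

Lemma linear_dependence (F : fieldType) (I J : finType) (k : I -> J -> F) :
  (#|J| < #|I|)%N ->
  exists2 c : I -> F, exists i, c i != 0 & forall j, \sum_i c i * k i j = 0.
Proof.
move=> JI; pose M := \matrix_(i < #|I|, j < #|J|) k (enum_val i) (enum_val j).
have : kermx M != 0.
  rewrite kermx_eq0 /row_free neq_ltn; apply/orP; left.
  exact: leq_ltn_trans (rank_leq_col _) JI.
move=> /rowV0Pn[c /sub_kermxP cM /rV0Pn[i ci]].
exists (fun i => c 0 (enum_rank i)); first by exists (enum_val i); rewrite enum_valK.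
move=> j; have := congr1 (fun A : 'rV_ _ => A 0 (enum_rank j)) cM.
rewrite !mxE => h; rewrite -[RHS]h (reindex (@enum_val I I)) /=; last exact: onW_bij (enum_val_bij _).
by apply: eq_bigr => l _; rewrite enum_valK mxE enum_rankK.
Qed.

Section Dickson.

Lemma nondecreasing_subseq (u : nat -> nat) : exists phi : nat -> nat,
  (forall i j, (i < j)%N -> (phi i < phi j)%N) /\
  (forall i j, (i < j)%N -> (u (phi i) <= u (phi j))%N).
Proof.
have ex n : exists k, (n <= k)%N /\ forall l, (n <= l)%N -> (u k <= u l)%N.
  pose P v := `[< exists2 k, (n <= k)%N & u k = v >].
  have exP : exists v, P v by exists (u n); apply/asboolP; exists n.
  have [v /asboolP[k nk uk] vmin] := ex_minnP exP.
  by exists k; split=> // l nl; rewrite uk; apply: vmin; apply/asboolP; exists l.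
have [f hf] := choice ex.
pose phi := fix phi i := if i is i'.+1 then f (phi i').+1 else f 0%N.
have phi_lt i : (phi i < phi i.+1)%N by have [] := hf (phi i).+1.
have mono i j : (i < j)%N -> (phi i < phi j)%N.
  elim: j => // j IH; rewrite ltnS leq_eqVlt => /orP[/eqP ->|/IH h]; first exact: phi_lt.
  exact: ltn_trans h (phi_lt j).
exists phi; split=> // i j /mono ij.
case: i ij => [|i] ij; first by have [_ ->] := hf 0%N.
have [le1 ->] // := hf (phi i).+1.
exact: leq_trans le1 (ltnW ij).
Qed.

Lemma dickson n (m : nat -> 'X_{1..n}) : exists i j, (i < j)%N /\ (m i <= m j)%MM.
Proof.
suff H k : exists phi : nat -> nat,
    (forall i j, (i < j)%N -> (phi i < phi j)%N) /\
    (forall (c : 'I_n) i j, (c < k)%N -> (i < j)%N -> (m (phi i) c <= m (phi j) c)%N).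
  have [phi [hphi hm]] := H n; exists (phi 0%N), (phi 1%N); split; first exact: hphi.
  by apply/mnm_lepP => c; apply: hm.
elim: k => [|k [phi [hphi hm]]]; first by exists id.
have [kn|kn] := ltnP k n; last first.
  by exists phi; split=> // c i j _; apply: hm; apply: leq_trans (ltn_ord c) kn.
have [psi [hpsi hmk]] := nondecreasing_subseq (fun i => m (phi i) (Ordinal kn)).
exists (phi \o psi); split=> [i j /hpsi/hphi //|c i j].
rewrite ltnS leq_eqVlt => /orP[/eqP ck|ck] ij; last by apply: hm => //; apply: hpsi.
by rewrite (_ : c = Ordinal kn); [exact: hmk | exact/val_inj].
Qed.

End Dickson.

Section Noether.
Variables (F : fieldType) (n : nat).
Local Notation R := {mpoly F[n]}.

Definition ideal (I : set R) : Prop :=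
  [/\ I 0, forall p q, I p -> I q -> I (p + q) & forall p q, I q -> I (p * q)].

Lemma idealB I p q : ideal I -> I p -> I q -> I (p - q).
Proof. by case=> _ ID IM Ip Iq; apply: ID => //; rewrite -mulN1r; apply: IM. Qed.

(** Among the elements of [I k.+1] outside [I k] choose one with least leading
    monomial; by Dickson's lemma some choice could be reduced by an earlier
    one. *)
Lemma ideal_chain (I : nat -> set R) : (forall k, ideal (I k)) ->
  (forall k, I k `<=` I k.+1) -> exists k, I k.+1 `<=` I k.
Proof.
move=> idI sub; apply: contrapT => nstat.
have mono i j : (i <= j)%N -> I i `<=` I j.
  elim: j => [|j IH]; first by rewrite leqn0 => /eqP ->.
  rewrite leq_eqVlt => /orP[/eqP -> //|/IH h]; exact: subset_trans h (sub j).
have ex k : exists p, [/\ I k.+1 p, ~ I k p &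
    forall q, I k.+1 q -> ~ I k q -> ~ (mlead q < mlead p)%O].
  have [p0 h0] : exists p, I k.+1 p /\ ~ I k p.
    apply: contrapT => nex; apply: nstat; exists k => p Ip; apply: contrapT => nIp.
    by apply: nex; exists p.
  have [mu emu] : exists mu, mu = mlead p0 by exists (mlead p0).
  elim/(well_founded_ind (@ltom_wf n)): mu p0 h0 emu => mu IH p0 [h0 h0'] emu.
  have [[q [Iq nIq lt]]|nq] := pselect (exists q, [/\ I k.+1 q, ~ I k q & (mlead q < mlead p0)%O]).
    by apply: (IH (mlead q)) (erefl _); rewrite ?emu.
  by exists p0; split=> // q Iq nIq lt; apply: nq; exists q.
have [f hf] := choice ex.
have [i [j [ij le]]] := dickson (fun k => mlead (f k)).
have [fi nfi _] := hf i; have [fj nfj minj] := hf j.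
have nzi : f i != 0 by apply/eqP => e; apply: nfi; rewrite e; case: (idI i).
have nzj : f j != 0 by apply/eqP => e; apply: nfj; rewrite e; case: (idI j).
pose q := (mleadc (f j) / mleadc (f i)) *: 'X_[mlead (f j) - mlead (f i)] * f i.
have Iq : I j q by case: (idI j) => _ _ IM; apply: IM; apply: mono fi.
have leadq : mlead q = mlead (f j) /\ mleadc q = mleadc (f j).
  have c0 : mleadc (f j) / mleadc (f i) != 0.
    by rewrite mulf_eq0 invr_eq0 !mleadc_eq0 (negPf nzi) (negPf nzj).
  have nzX : 'X_[mlead (f j) - mlead (f i)] != 0 :> R by rewrite -mleadc_eq0 mleadXm mcoeffX eqxx oner_eq0.
  have lq : mlead q = mlead (f j).
    by rewrite /q -scalerAl mleadZ // mleadM // mleadXm submK.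
  split=> //; rewrite /q -scalerAl mleadcZE mleadcM_proper.
    by rewrite mleadXm mcoeffX eqxx mul1r mulfVK // mleadc_eq0.
  by rewrite mulf_neq0 // mleadc_eq0.
have nIfq : ~ I j (f j - q).
  move=> h; apply: nfj; rewrite -[f j](subrK q).
  by case: (idI j) => _ ID _; apply: ID.
apply: (minj (f j - q)) => //.
  by apply: idealB => //; apply: sub.
have [lq cq] := leadq.
rewrite lt_neqAle; apply/andP; split; last first.
  by have := mleadB_le (f j) q; rewrite lq joinxx.
apply/eqP => e; have : f j - q == 0.
  by rewrite -mleadc_eq0 e mcoeffB -{2}lq cq subrr.
by move=> /eqP e0; apply: nIfq; rewrite e0; case: (idI j).
Qed.

Lemma ideal_maximal (P : set (set R)) : (forall I, P I -> ideal I) -> P !=set0 ->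
  exists2 M, P M & forall J, P J -> M `<=` J -> J `<=` M.
Proof.
move=> Pid [I0 PI0]; apply: contrapT => nex.
have ex (I : {I | P I}) : exists J : {I | P I}, sval I `<=` sval J /\ ~ sval J `<=` sval I.
  case: I => I PI /=; apply: contrapT => nJ; apply: nex; exists I => // J PJ IJ.
  by apply: contrapT => nJI; apply: nJ; exists (exist _ J PJ).
have [f hf] := choice ex.
pose I k := sval (iter k f (exist _ I0 PI0)).
have [k|k|k] := @ideal_chain I.
- by rewrite /I; case: (iter k f _) => J /= /Pid.
- by have [] := hf (iter k f (exist _ I0 PI0)).
by have [] := hf (iter k f (exist _ I0 PI0)).
Qed.

End Noether.

(** * A graded Nullstellensatz over an uncountable field *)

Section Homogenize.
Variables (F : fieldType) (n : nat) (x y : {mpoly F[n]}).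
Local Notation R := {mpoly F[n]}.
Implicit Types q : {poly F}.

(** The homogenization of [q], of degree [D], evaluated at [x] and [y]. *)
Definition homogenize D (q : {poly F}) : R :=
  \sum_(k < D.+1) q`_k *: (x ^+ k * y ^+ (D - k)).

Lemma homogenizeS D q : (size q <= D.+1)%N -> homogenize D.+1 q = y * homogenize D q.
Proof.
move=> sq; rewrite /homogenize big_ord_recr /= (nth_default _ sq) scale0r addr0.
rewrite mulr_sumr; apply: eq_bigr => k _ /=.
by rewrite -scalerAr mulrCA -exprS subSn // -ltnS.
Qed.

Lemma homogenize_linear D a q : (size q <= D.+1)%N ->
  homogenize D.+1 (('X - a%:P) * q) = (x - a *: y) * homogenize D q.
Proof.
move=> sq; rewrite mulrBl /homogenize.
under eq_bigr => k _ do rewrite coefB coefCM scalerBl.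
rewrite sumrB mulrBl; congr (_ - _).
  rewrite big_ord_recl coefXM /= scale0r add0r mulr_sumr; apply: eq_bigr => k _.
  by rewrite coefXM /= -scalerAr mulrA -exprS.
rewrite big_ord_recr /= (nth_default _ sq) mulr0 scale0r addr0.
rewrite mulr_sumr; apply: eq_bigr => k _ /=.
by rewrite -scalerAl -!scalerAr scalerA mulrCA -exprS subSn // -ltnS.
Qed.

Lemma homogenize_prod s :
  homogenize (size s) (\prod_(a <- s) ('X - a%:P)) = \prod_(a <- s) (x - a *: y).
Proof.
elim: s => [|a s IH].
  by rewrite !big_nil /homogenize big_ord1 /= coef1 scale1r !expr0 mulr1.
by rewrite !big_cons /= homogenize_linear ?IH // size_prod_XsubC.
Qed.

Lemma homogenize_sum D (I : finType) (c : I -> F) (q : I -> {poly F}) :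
  homogenize D (\sum_i c i *: q i) = \sum_i c i *: homogenize D (q i).
Proof.
rewrite /homogenize; under [RHS]eq_bigr => i _ do rewrite scaler_sumr.
rewrite exchange_big; apply: eq_bigr => k _ /=; rewrite coef_sum scaler_suml.
by apply: eq_bigr => i _; rewrite coefZ scalerA.
Qed.

Lemma homogenizeZ D a q : homogenize D (a *: q) = a *: homogenize D q.
Proof.
rewrite /homogenize scaler_sumr; apply: eq_bigr => k _.
by rewrite coefZ scalerA.
Qed.

Lemma homogenize_add D q k : (size q <= D.+1)%N ->
  homogenize (k + D) q = y ^+ k * homogenize D q.
Proof.
move=> sq; elim: k => [|k IH]; first by rewrite mul1r.
rewrite addSn homogenizeS ?IH ?exprS ?mulrA //.
by apply: leq_trans sq _; rewrite ltnS leq_addl.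
Qed.

End Homogenize.

Lemma infinite_fiber (T : Type) (I : countType) (f : T -> I) :
  ~ countable [set: T] -> exists i, infinite_set [set t | f t = i].
Proof.
move=> unc; apply: contrapT => nex; apply: unc.
have -> : [set: T] = \bigcup_(i in [set: I]) [set t | f t = i].
  by apply/seteqP; split=> // t _; exists (f t).
apply: bigcup_countable => [|i _]; first exact: countableP.
apply: finite_set_countable; apply: contrapT => inf.
by apply: nex; exists i.
Qed.

Lemma infinite_uniq_seq (T : choiceType) (A : set T) k : infinite_set A ->
  exists s : seq T, [/\ uniq s, size s = k & forall t, t \in s -> A t].
Proof.
move=> /(infinite_set_fset k)[B BA kB]; exists (take k (finmap.enum_fset B)); split.
- by rewrite take_uniq // finmap.fset_uniq.
- by rewrite size_takel.
- by move=> t /mem_take tB; apply: BA.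
Qed.

Section GradedNullstellensatz.
Variables (F : closedFieldType) (n : nat).
Hypothesis unc : ~ countable [set: F].
Local Notation R := {mpoly F[n]}.
Implicit Types (J M : set R).

Lemma ideal_sum M (I : Type) (r : seq I) (P : pred I) (G : I -> R) :
  ideal M -> (forall i, P i -> M (G i)) -> M (\sum_(i <- r | P i) G i).
Proof. by case=> M0 MD _ h; elim/big_ind: _. Qed.

Lemma idealZ M c p : ideal M -> M p -> M (c *: p).
Proof. by case=> _ _ MM Mp; rewrite -mul_mpolyC; apply: MM. Qed.

(** Let [M] be maximal among the ideals that contain [J] and no power of the
    variable [X_i].  If [X_l - a X_i] was outside [M] for all [a], then each of
    them would divide a power of [X_i] modulo [M]; uncountably many of the quotients have the same
    degree, so are linearly dependent, and clearing denominators in a linear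
    relation yields an element of [M] that is a form in [X_i] and [X_l]. *)
Lemma graded_nullstellensatz (i : 'I_n) J : ideal J ->
    (forall k, ~ J ('X_i ^+ k)) ->
  exists b : 'rV[F]_n, b 0 i = 1 /\
    forall m (g : R), g \is m.-homog -> J g -> g.@[b 0] = 0.
Proof.
move=> idJ nJ.
pose P M := [/\ ideal M, J `<=` M & forall k, ~ M ('X_i ^+ k)].
have [M [idM JM nM] Mmax] : exists2 M, P M & forall J', P J' -> M `<=` J' -> J' `<=` M.
  apply: ideal_maximal; first by move=> M [].
  by exists J; split=> //; exact: subset_refl.
have [M0 MD MM] := idM.
have inv g : ~ M g -> exists h k, M (g * h - 'X_i ^+ k).
  move=> nMg; pose I := [set p | exists a h, M a /\ p = a + g * h].
  have [nP|/forallNP nP] := pselect (exists k, I ('X_i ^+ k)).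
    have [k [a [h [Ma e]]]] := nP; exists h, k.
    rewrite e opprD addrCA subrr addr0 -mulN1r; exact: MM.
  exfalso; apply: nMg; apply: (Mmax I) => [|p Mp|].
  - split; last exact: nP.
    + split.
      * by exists 0, 0; rewrite mulr0 addr0.
      * move=> _ _ [a [h [Ma ->]]] [a' [h' [Ma' ->]]]; exists (a + a'), (h + h').
        by split; [apply: MD | ring].
      * move=> p _ [a [h [Ma ->]]]; exists (p * a), (p * h).
        by split; [apply: MM | ring].
    + by move=> p /JM Mp; exists p, 0; rewrite mulr0 addr0.
  - by exists p, 0; rewrite mulr0 addr0.
  - by exists 0, 1; rewrite mulr1 add0r.
have prime g g' : M (g * g') -> M g \/ M g'.
  move=> Mgg; apply: contrapT => /not_orP[/inv[h [k Mh]] /inv[h' [k' Mh']]].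
  apply: (nM (k + k')%N).
  have -> : 'X_i ^+ (k + k') = h * h' * (g * g') - g' * h' * (g * h - 'X_i ^+ k)
      - 'X_i ^+ k * (g' * h' - 'X_i ^+ k') :> R by rewrite exprD; ring.
  by apply: idealB => //; [apply: idealB => // |]; apply: MM.
have primeX k g : M ('X_i ^+ k * g) -> M g.
  by move=> /prime[/nM|].
have lin l : exists b, M ('X_l - b *: 'X_i).
  apply: contrapT => nb.
  have ex b : exists hk : R * nat, M (('X_l - b *: 'X_i) * hk.1 - 'X_i ^+ hk.2).
    have [|h [k Mhk]] := inv ('X_l - b *: 'X_i); last by exists (h, k).
    by move=> Mb; apply: nb; exists b.
  have [H hH] := choice ex.
  have [[sz k] inf] := infinite_fiber (fun b => (msize (H b).1, (H b).2)) unc.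
  have [s [us ss hs]] := infinite_uniq_seq #|{: 'X_{1..n < sz}}|.+1 inf.
  have lt : (#|{: 'X_{1..n < sz}}| < #|'I_(size s)|)%N by rewrite card_ord ss.
  have [c [j0 cj0] hc] := linear_dependence
    (fun (j : 'I_(size s)) (m : 'X_{1..n < sz}) => (H s`_j).1@_m) lt.
  have sumH : \sum_(j < size s) c j *: (H s`_j).1 = 0.
    apply/mpolyP => m; rewrite mcoeff0 raddf_sum /=.
    have [ms|ms] := ltnP (mdeg m) sz.
      rewrite -[RHS](hc (BMultinom ms)); apply: eq_bigr => j _.
      by rewrite mcoeffZ.
    apply: big1 => j _; rewrite mcoeffZ memN_msupp_eq0 ?mulr0 // msize_mdeg_ge //.
    by have [-> _] := hs _ (mem_nth 0 (ltn_ord j)).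
  pose q := \sum_(j < size s) c j *: \prod_(a <- rem s`_j s) ('X - a%:P).
  have nzq : q != 0.
    apply/eqP => /(congr1 (fun p : {poly F} => p.[s`_j0])); rewrite horner0.
    rewrite horner_sum (bigD1 j0) //= [X in _ + X]big1 => [|j jj]; last first.
      rewrite hornerZ horner_prod (bigD1_seq s`_j0) ?rem_uniq //=.
        by rewrite hornerXsubC subrr mul0r mulr0.
      by rewrite mem_rem_uniq // inE mem_nth // nth_uniq // eq_sym jj.
    rewrite addr0 hornerZ horner_prod => /eqP; rewrite mulf_eq0 (negPf cj0) /=.
    rewrite prodf_seq_eq0 => /hasP[a]; rewrite mem_rem_uniq // inE => /andP[ne _].
    by rewrite /= !hornerE subr_eq0 eq_sym (negPf ne).
  set D := (size s).-1.
  have szr (j : 'I_(size s)) : size (rem s`_j s) = D by rewrite size_rem // mem_nth.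
  have szq : (size q <= D.+1)%N.
    apply: leq_trans (size_sum _ _ _) _; apply/bigmax_leqP => j _.
    by apply: leq_trans (size_scale_leq _ _) _; rewrite size_prod_XsubC szr.
  have Mq : M (homogenize 'X_l 'X_i D q).
    rewrite homogenize_sum; apply: (primeX k).
    have -> : 'X_i ^+ k * \sum_(j < size s) c j *:
        homogenize 'X_l 'X_i D (\prod_(a <- rem s`_j s) ('X - a%:P)) =
      \prod_(a <- s) ('X_l - a *: 'X_i) * (\sum_(j < size s) c j *: (H s`_j).1) -
      \sum_(j < size s) c j *: (\prod_(a <- rem s`_j s) ('X_l - a *: 'X_i) *
        (('X_l - s`_j *: 'X_i) * (H s`_j).1 - 'X_i ^+ k)) :> R.
      rewrite !mulr_sumr -sumrB; apply: eq_bigr => j _.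
      rewrite -(szr j) homogenize_prod -!scalerAr -scalerBr; congr (_ *: _).
      rewrite [\prod_(a <- s) _](big_rem s`_j) ?mem_nth //=.
      move: ('X_l - _) (\prod_(_ <- _) _) (H _).1 ('X_i ^+ k) => u1 u2 u3 u4.
      by ring.
    rewrite sumH mulr0 sub0r -mulN1r; apply: (MM); apply: ideal_sum => // j _.
    apply: idealZ => //; apply: (MM).
    by have [_ <-] := hs _ (mem_nth 0 (ltn_ord j)); apply: hH.
  have [rs eq] := closed_field_poly_normal q.
  have lc0 : lead_coef q != 0 by rewrite lead_coef_eq0.
  have szrs : (size rs <= D)%N.
    by move: szq; rewrite eq size_scale // size_prod_XsubC.
  move: Mq; rewrite eq homogenizeZ -(subnK szrs) homogenize_add ?size_prod_XsubC //.
  rewrite homogenize_prod -mul_mpolyC => /prime[Mc|/primeX Mp].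
    apply: (nM 0%N); rewrite expr0 -mpolyC1 -[X in X%:MP](mulVf lc0) mpolyCM.
    exact: (MM).
  suff [a Ma] : exists a, M ('X_l - a *: 'X_i) by apply: nb; exists a.
  elim: rs Mp {eq szrs} => [|a rs IH].
    by rewrite big_nil => M1; exfalso; apply: (nM 0%N); rewrite expr0.
  by rewrite big_cons => /prime[Ma|/IH //]; exists a.
have [b hb] := choice lin.
have bi : b i = 1.
  apply: contrapT => /eqP bi; have nz : 1 - b i != 0 by rewrite subr_eq0 eq_sym.
  apply: (nM 1%N); have := idealZ (1 - b i)^-1 idM (hb i).
  by rewrite -{1}['X_i]scale1r -scalerBl scalerA mulVf // scale1r expr1.
exists (\row_l b l); split=> [|m g hg Jg]; first by rewrite mxE.
have comp p p' k k' c c' : M (p - c *: 'X_i ^+ k) -> M (p' - c' *: 'X_i ^+ k') ->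
    M (p * p' - (c * c') *: 'X_i ^+ (k + k')%N).
  move=> h h'.
  have -> : p * p' - (c * c') *: 'X_i ^+ (k + k')%N =
      p' * (p - c *: 'X_i ^+ k) + (c *: 'X_i ^+ k) * (p' - c' *: 'X_i ^+ k').
    rewrite exprD -!mul_mpolyC mpolyCM; ring.
  by apply: MD; apply: MM.
have mon (mu : 'X_{1..n}) : M ('X_[mu] - (\prod_l b l ^+ mu l) *: 'X_i ^+ mdeg mu).
  rewrite mpolyXE_id mdegE.
  elim: (index_enum _) => [|l r IHr]; rewrite ?big_nil ?big_cons /=.
    by rewrite expr0 scale1r subrr.
  apply: (comp _ _ _ _ _ _ _ IHr).
  elim: (mu l) => [|k IH]; first by rewrite !expr0 scale1r subrr.
  have hl : M ('X_l - b l *: 'X_i ^+ 1) by rewrite expr1; apply: hb.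
  by have := comp _ _ _ _ _ _ hl IH; rewrite add1n -!exprS.
apply: contrapT => /eqP gb; apply: (nM m).
have Mg : M (g - g.@[(\row_l b l) 0] *: 'X_i ^+ m).
  rewrite {1}[g]mpolyE mevalE scaler_suml -sumrB big_seq; apply: ideal_sum => // mu mug.
  rewrite -scalerA -scalerBr; apply: idealZ => //.
  have /dhomogP/(_ _ mug)/= <- := hg.
  by under eq_bigr => l _ do rewrite mxE; exact: mon.
have := idealB idM (JM _ Jg) Mg; rewrite opprB addrC subrK => h.
by have := idealZ (g.@[(\row_l b l) 0])^-1 idM h; rewrite scalerA mulVf // scale1r.
Qed.

End GradedNullstellensatz.

(** * Growth of the coordinate ring of a cone *)

Section Pihomog.
Variables (F : fieldType) (n : nat).
Implicit Types (g h : {mpoly F[n]}).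

Lemma pihomog_eq0 h D : (msize h <= D)%N -> pihomog mdeg D h = 0.
Proof.
move=> Dh; rewrite pihomogE big_seq_cond big1 // => mu /andP[mus /eqP emu].
by have := msize_mdeg_lt mus; rewrite [mdeg mu]emu ltnNge Dh.
Qed.

Lemma pihomogMl m g h D : g \is m.-homog ->
  pihomog mdeg (m + D)%N (g * h) = g * pihomog mdeg D h.
Proof.
move=> hg; rewrite {1}(pihomog_partitionE (leqnn (msize h))) mulr_sumr raddf_sum /=.
have hk k : g * pihomog mdeg k h \is (m + k).-homog.
  by apply: dhomogM => //; exact: pihomogP.
have [Dh|Dh] := ltnP D (msize h).
  rewrite (bigD1 (Ordinal Dh)) //= pihomog_dE // big1 ?addr0 // => k kD.
  rewrite (@pihomog_ne0 _ _ _ (m + k)%N) //.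
  by rewrite eqn_add2l; apply: contra kD => /eqP e; apply/eqP/val_inj.
rewrite pihomog_eq0 // mulr0 big1 // => k _.
rewrite (@pihomog_ne0 _ _ _ (m + k)%N) // eqn_add2l neq_ltn.
by rewrite (leq_trans (ltn_ord k) Dh).
Qed.

(** They are the coefficients of [h (t x)] as a polynomial in [t]. *)
Lemma pihomog_vanish (char0 : forall k, k.+1%:R != 0 :> F) h (x : 'rV_n) D :
  (forall c, h.@[(c *: x) 0] = 0) -> (pihomog mdeg D h).@[x 0] = 0.
Proof.
move=> hx; pose q := \poly_(k < msize h) (pihomog mdeg k h).@[x 0].
have q0 : q = 0.
  apply: (poly_ext0 char0) => t _; rewrite -[RHS](hx t) horner_poly.
  rewrite [in RHS](pihomog_partitionE (leqnn (msize h))) raddf_sum /=.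
  by apply: eq_bigr => k _; rewrite (meval_dhomogZ _ _ (pihomogP _ _ _)) mulrC.
have [Dh|Dh] := ltnP D (msize h); last by rewrite pihomog_eq0 ?meval0.
by have := congr1 (fun p : {poly F} => p`_D) q0; rewrite coef_poly Dh coef0.
Qed.

End Pihomog.

Section Growth.
Variables (F : closedFieldType) (n : nat).
Hypothesis unc : ~ countable [set: F].
Hypothesis char0 : forall k, k.+1%:R != 0 :> F.
Local Notation R := {mpoly F[n]}.

Variables (S : set R) (m : nat) (g1 g2 : R).
Hypothesis homS : forall g, S g -> exists d, g \is d.-homog.
Let X : set 'rV[F]_n := [set x | forall g, S g -> g.@[x 0] = 0].
Hypothesis m0 : (0 < m)%N.
Hypothesis hg1 : g1 \is m.-homog.
Hypothesis hg2 : g2 \is m.-homog.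
Hypothesis no_zero : forall x, X x -> g1.@[x 0] = 0 -> g2.@[x 0] = 0 -> x = 0.

Let X_scale x c : X x -> X (c *: x).
Proof.
by move=> Xx g Sg; have [d hd] := homS Sg; rewrite (meval_dhomogZ _ _ hd) Xx ?mulr0.
Qed.

Let J : set R := [set p | exists h b c,
  (forall x, X x -> h.@[x 0] = 0) /\ p = h + g1 * b + g2 * c].

Let idJ : ideal J.
Proof.
split.
- by exists 0, 0, 0; split=> [x _|]; rewrite ?meval0 // !mulr0 !addr0.
- move=> _ _ [h [b [c [hX ->]]]] [h' [b' [c' [hX' ->]]]].
  exists (h + h'), (b + b'), (c + c'); split=> [x Xx|]; last by ring.
  by rewrite mevalD hX ?hX' ?addr0.
- move=> p _ [h [b [c [hX ->]]]]; exists (p * h), (p * b), (p * c).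
  by split=> [x Xx|]; [rewrite mevalM hX ?mulr0 | ring].
Qed.

(* By the graded Nullstellensatz, [J] having no zero but the origin. *)
Let power_in_J (i : 'I_n) : exists k, J ('X_i ^+ k).
Proof.
apply: contrapT => /forallNP nJ.
have [b [bi hb]] := graded_nullstellensatz unc idJ nJ.
have Xb : X b.
  move=> g Sg; have [d hd] := homS Sg; apply: (hb d) => //.
  by exists g, 0, 0; split=> [x|]; [exact | rewrite !mulr0 !addr0].
have b0 : b = 0.
  apply: no_zero => //; apply: (hb m) => //.
    by exists 0, 1, 0; split=> [x _|]; rewrite ?meval0 // mulr1 mulr0 add0r addr0.
  by exists 0, 0, 1; split=> [x _|]; rewrite ?meval0 // mulr1 mulr0 !add0r.
by move: bi; rewrite b0 mxE => /eqP; rewrite eq_sym oner_eq0.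
Qed.

(* A monomial of large degree is divisible by a high power of some variable. *)
Let high_degree : exists e, (m <= e)%N /\
  forall mu : 'X_{1..n}, (e <= mdeg mu)%N -> J 'X_[mu].
Proof.
have [k hk] := choice power_in_J.
exists (m + \sum_i k i)%N; split=> [|mu]; first exact: leq_addr.
move=> le; have [i ki] : exists i, (k i <= mu i)%N.
  apply: contrapT => /forallNP h; move: le; apply/negP; rewrite -ltnNge mdegE.
  apply: leq_ltn_trans (_ : \sum_i k i < _)%N; last by rewrite -[X in (X < _)%N]add0n ltn_add2r.
  by apply: leq_sum => i _; apply: ltnW; rewrite ltnNge; apply/negP/h.
rewrite -(submK (_ : U_(i) *+ k i <= mu)%MM); last first.
  apply/mnm_lepP => j; rewrite mulmnE mnm1E; case: eqP => [<-|_]; last by rewrite mul0n.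
  by rewrite mul1n.
by rewrite mpolyXD -mpolyXn; case: idJ => _ _; apply.
Qed.

(** Polynomials are only considered up to equality on the cone, which is why this
    is not a linear span in the polynomial ring. *)
Inductive cone_span (e D : nat) : R -> Prop :=
| SpanGen i j (nu : 'X_{1..n}) : (mdeg nu < e)%N -> ((i + j) * m + mdeg nu = D)%N ->
    cone_span e D (g1 ^+ i * g2 ^+ j * 'X_[nu])
| SpanZero : cone_span e D 0
| SpanAdd p q : cone_span e D p -> cone_span e D q -> cone_span e D (p + q)
| SpanScale c p : cone_span e D p -> cone_span e D (c *: p)
| SpanEq p q : cone_span e D p -> (forall x, X x -> p.@[x 0] = q.@[x 0]) -> cone_span e D q.

Lemma span_mul1 e D q : cone_span e D q -> cone_span e (m + D) (g1 * q).
Proof.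
elim=> {q} [i j nu nue ij||p q _ IHp _ IHq|c p _ IHp|p q _ IHp pq].
- rewrite !mulrA -exprS; apply: SpanGen => //.
  by rewrite -ij addSn mulSn addnA.
- by rewrite mulr0; apply: SpanZero.
- by rewrite mulrDr; apply: SpanAdd.
- by rewrite -scalerAr; apply: SpanScale.
- by apply: SpanEq IHp _ => x Xx; rewrite !mevalM pq.
Qed.

Lemma span_mul2 e D q : cone_span e D q -> cone_span e (m + D) (g2 * q).
Proof.
elim=> {q} [i j nu nue ij||p q _ IHp _ IHq|c p _ IHp|p q _ IHp pq].
- rewrite (_ : g2 * _ = g1 ^+ i * g2 ^+ j.+1 * 'X_[nu]); last by rewrite exprS; ring.
  by apply: SpanGen => //; rewrite -ij addnS mulSn addnA.
- by rewrite mulr0; apply: SpanZero.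
- by rewrite mulrDr; apply: SpanAdd.
- by rewrite -scalerAr; apply: SpanScale.
- by apply: SpanEq IHp _ => x Xx; rewrite !mevalM pq.
Qed.

Lemma span_sum e D (I : eqType) (r : seq I) (G : I -> R) :
  (forall i, i \in r -> cone_span e D (G i)) -> cone_span e D (\sum_(i <- r) G i).
Proof.
elim: r => [|i r IH] h; rewrite ?big_nil ?big_cons; first exact: SpanZero.
apply: SpanAdd; first by apply: h; rewrite mem_head.
by apply: IH => j jr; apply: h; rewrite inE jr orbT.
Qed.

Let span_all : exists e, forall D q, q \is D.-homog -> cone_span e D q.
Proof.
have [e [me he]] := high_degree; exists e.
elim/ltn_ind => D IH q /dhomogP hq; rewrite [q]mpolyE; apply: span_sum => mu muq.
apply: SpanScale; have := hq _ muq => /= emu.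
have [lt|le] := ltnP D e.
  rewrite -['X_[mu]]mul1r -[1]mulr1 -{1}(expr0 g1) -{1}(expr0 g2).
  by apply: SpanGen; rewrite ?emu ?addn0 ?mul0n.
have [|h [b [c [hX eX]]]] := he mu; first by rewrite emu.
have mD : (m <= D)%N := leq_trans me le.
have DmD : (D - m < D)%N by rewrite -subn_gt0 subKn.
have e2 : 'X_[mu] = pihomog mdeg D h + g1 * pihomog mdeg (D - m)%N b
    + g2 * pihomog mdeg (D - m)%N c.
  have := congr1 (pihomog mdeg D) eX.
  rewrite pihomog_dE ?dhomogX /= ?emu // !pihomogD.
  have := pihomogMl b (D - m) hg1; have := pihomogMl c (D - m) hg2.
  by rewrite subnKC // => -> ->.
apply: (@SpanEq _ _ (g1 * pihomog mdeg (D - m)%N b + g2 * pihomog mdeg (D - m)%N c)).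
  rewrite -{1}(subnKC mD).
  by apply: SpanAdd; [apply: span_mul1|apply: span_mul2]; apply: IH => //; apply: pihomogP.
move=> x Xx; rewrite e2 -addrA [RHS]mevalD pihomog_vanish ?add0r // => t.
by apply: hX; apply: X_scale.
Qed.

(** The forms of degree [D] on the cone span a space whose dimension
    grows linearly with [D], while there are quadratically many monomials of
    degree [D] in three coordinates. *)
Theorem three_coordinates_dependent (a b c : 'I_n) :
  exists k (Q : {mpoly F[3]}), [/\ Q != 0, Q \is k.-homog &
    forall x : 'rV_n, X x ->
      Q.@[(\row_(l < 3) [:: x 0 a; x 0 b; x 0 c]`_l) 0] = 0].
Proof.
have [e he] := span_all.
have rep D q : cone_span e D q -> exists k : 'I_D.+1 * 'X_{1..n < e} -> F,
    forall x, X x -> q.@[x 0] = \sum_j k j * (g1.@[x 0] ^+ j.1 *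
      g2.@[x 0] ^+ ((D - mdeg j.2) %/ m - j.1) * 'X_[j.2].@[x 0]).
  elim=> {q} [i j nu nue ij||p q _ [k hk] _ [k' hk']|t p _ [k hk]|p q _ [k hk] pq].
  - have iD : (i < D.+1)%N.
      rewrite ltnS -ij; apply: leq_trans (leq_addr _ _).
      by apply: leq_trans (leq_addr j i) _; rewrite leq_pmulr.
    exists (fun l => (l == (Ordinal iD, BMultinom nue))%:R) => x Xx.
    rewrite (bigD1 (Ordinal iD, BMultinom nue)) //= eqxx mul1r big1 ?addr0; last first.
      by move=> l /negPf ->; rewrite mul0r.
    rewrite -ij addnK mulnK // addKn.
    by rewrite !mevalM !rmorphXn.
  - exists (fun=> 0) => x Xx; rewrite meval0 big1 // => j _; exact: mul0r.
  - exists (fun j => k j + k' j) => x Xx; rewrite mevalD hk ?hk' // -big_split /=.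
    by apply: eq_bigr => j _; rewrite mulrDl.
  - exists (fun j => t * k j) => x Xx; rewrite mevalZ hk // mulr_sumr.
    by apply: eq_bigr => j _; rewrite mulrA.
  - by exists k => x Xx; rewrite -pq // hk.
(* The width [w] is chosen so that [(w + 1) ^ 2 > (2 w + 1) C]. *)
pose C := #|{: 'X_{1..n < e}}|; pose w := (2 * C)%N; pose D := (2 * w)%N.
pose mono (st : 'I_w.+1 * 'I_w.+1) : 'X_{1..3} :=
  [multinom nth 0%N [:: (st.1 : nat); (st.2 : nat); (D - st.1 - st.2)%N] l | l < 3].
have le_w (s : 'I_w.+1) : (s <= w)%N by rewrite -ltnS.
have mono_deg st : mdeg (mono st) = D.
  rewrite mdegE !big_ord_recl big_ord0 !mnmE /=.
  by move: (le_w st.1) (le_w st.2); rewrite /D; lia.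
have mono_inj : injective mono.
  move=> [s t] [s' t'] /mnmP h; have := h 0; have := h 1; rewrite !mnmE /=.
  by move=> e1 e2; congr (_, _); apply/val_inj.
pose coord (st : 'I_w.+1 * 'I_w.+1) : R :=
  'X_a ^+ st.1 * 'X_b ^+ st.2 * 'X_c ^+ (D - st.1 - st.2).
have coord_hom st : coord st \is D.-homog.
  have h (i : 'I_n) k : ('X_i ^+ k : R) \is k.-homog.
    by rewrite -[k in k.-homog]mul1n; apply: dhomogMn; rewrite dhomogX /= mdeg1.
  have -> : D = (st.1 + st.2 + (D - st.1 - st.2))%N.
    by move: (le_w st.1) (le_w st.2); rewrite /D; lia.
  by do !apply: dhomogM.
have [k hk] := choice (fun st => rep D _ (he D _ (coord_hom st))).
have lt : (#|{: 'I_D.+1 * 'X_{1..n < e}}| < #|{: 'I_w.+1 * 'I_w.+1}|)%N.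
  by rewrite !card_prod !card_ord -/C /D /w; nia.
have [cc [st0 nz0] hcc] := linear_dependence k lt.
exists D, (\sum_st cc st *: 'X_[mono st]); split.
- apply/eqP => /mpolyP/(_ (mono st0)); rewrite mcoeff0 raddf_sum /= (bigD1 st0) //=.
  rewrite mcoeffZ mcoeffX eqxx mulr1 big1 ?addr0; first by move/eqP; rewrite (negPf nz0).
  move=> st ne; rewrite mcoeffZ mcoeffX (negPf (_ : mono st != mono st0)) ?mulr0 //.
  by apply: contra ne => /eqP/mono_inj ->.
- by apply: rpred_sum => st _; apply: rpredZ; rewrite dhomogX /= mono_deg.
move=> x Xx; rewrite raddf_sum /=.
have E st : 'X_[mono st].@[(\row_(l < 3) [:: x 0 a; x 0 b; x 0 c]`_l) 0] =
    (coord st).@[x 0].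
  rewrite mevalX !big_ord_recl big_ord0 !mxE !mnmE /= mulr1.
  by rewrite !mevalM !rmorphXn /= !mevalXU mulrA.
under eq_bigr => st _ do rewrite mevalZ E hk // mulr_sumr.
rewrite exchange_big big1 //= => j _.
under eq_bigr => st _ do rewrite mulrA.
by rewrite -mulr_suml hcc mul0r.
Qed.

End Growth.

(** * Curves in projective space *)

(** By nested intervals, the successive ones avoiding the successive terms of an
    enumeration. *)
Lemma uncountable_real (R : realType) : ~ countable [set: R].
Proof.
move=> /countable_injP[f finj].
have [g hg] : exists g : nat -> R, forall x, g (f x) = x.
  have ex k : exists y : R, forall x, f x = k -> y = x.
    have [[x fx]|nx] := pselect (exists x, f x = k); last first.
      by exists 0 => x fx; exfalso; apply: nx; exists x.
    by exists x => z fz; apply: finj; rewrite ?inE // fx.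
  by have [g hg] := choice ex; exists g => x; apply: hg.
pose next (I : R * R) c : R * R :=
  if c < (I.1 + I.2) / 2 then ((I.1 + 2 * I.2) / 3, I.2)
  else (I.1, (2 * I.1 + I.2) / 3).
pose I := fix I k := if k is k'.+1 then next (I k') (g k') else (0, 1).
have lt k : (I k).1 < (I k).2.
  elim: k => [|k IH] /=; first exact: ltr01.
  by rewrite /next; case: ifP => _ /=; move: IH; lra.
have step k : (I k).1 <= (I k.+1).1 /\ (I k.+1).2 <= (I k).2.
  by rewrite /= /next; have := lt k; case: ifP => _ /=; lra.
have mono k l : (k <= l)%N -> (I k).1 <= (I l).1 /\ (I l).2 <= (I k).2.
  elim: l => [|l IH]; first by rewrite leqn0 => /eqP ->.
  rewrite leq_eqVlt => /orP[/eqP -> //|/IH[h1 h2]]; have [h3 h4] := step l.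
  by split; [exact: le_trans h1 h3 | exact: le_trans h4 h2].
have ub k l : (I k).1 <= (I l).2.
  have [/mono[h _]|/ltnW/mono[_ h]] := leqP k l.
    exact: le_trans h (ltW (lt l)).
  exact: le_trans (ltW (lt k)) h.
pose A := [set (I k).1 | k in [set: nat]].
have hs : has_sup A.
  split; first by exists (I 0%N).1, 0%N.
  by exists (I 0%N).2 => _ [k _ <-]; apply: ub.
have lo k : (I k).1 <= sup A by apply: ub_le_sup; [case: hs | exists k].
have hi k : sup A <= (I k).2.
  by apply: ge_sup; [case: hs | move=> _ [l _ <-]; apply: ub].
have := lo (f (sup A)).+1; have := hi (f (sup A)).+1.
rewrite /= hg /next; have := lt (f (sup A)); case: ifP => /=; lra.
Qed.

Lemma uncountable_complex (R : realType) : ~ countable [set: R[i]%C].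
Proof.
move=> /countable_injP[f finj]; apply: (@uncountable_real R).
apply/countable_injP; exists (fun x : R => f x%:C%C) => x y _ _ /finj e.
by have [] := e (mem_setT _) (mem_setT _).
Qed.

Section Points.
Variables (F : closedFieldType) (N : nat).
Hypothesis unc : ~ countable [set: F].
Hypothesis char0 : forall k, k.+1%:R != 0 :> F.
Local Notation point := (proj_point F N).
Local Notation R := {mpoly F[N.+1]}.
Local Notation closed := (@zariski_closed F N).
Implicit Types (p q : point) (x y : 'rV[F]_N.+1) (g : R) (Z : set point).

Definition point_of x (x0 : x != 0) : point.
Proof. by exists <[x]>%VS; rewrite dim_vline x0. Defined.

Lemma point_of_mem x (x0 : x != 0) : x \in val (point_of x0).
Proof. exact: memv_line. Qed.

Lemma point_span p x : x \in val p -> x != 0 -> val p = <[x]>%VS.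
Proof.
move=> xp x0; apply/esym/eqP; rewrite eqEdim dim_vline x0 (eqP (valP p)) andbT.
by rewrite -memvE.
Qed.

Lemma point_ex p : exists2 x, x != 0 & x \in val p.
Proof.
exists (vpick (val p)); last exact: memv_pick.
by rewrite vpick0 -dimv_eq0 (eqP (valP p)).
Qed.

Lemma vanishes_atP p x g d : x \in val p -> x != 0 -> g \is d.-homog ->
  vanishes_at g p <-> g.@[x 0] = 0.
Proof.
move=> xp x0 hg; split=> [|gx v]; first exact.
rewrite (point_span xp x0) => /vlineP[c ->].
by rewrite (meval_dhomogZ _ _ hg) gx mulr0.
Qed.

Definition vanishing_ideal Z : set R := [set g | forall p, Z p -> vanishes_at g p].

Lemma ideal_vanishing Z : ideal (vanishing_ideal Z).
Proof.
split=> [p _ v _|g h hg hh p Zp v vp|g h hh p Zp v vp]; first exact: meval0.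
  by rewrite mevalD (hg p) // (hh p) // addr0.
by rewrite mevalM (hh p) // mulr0.
Qed.

Lemma closed_vanishing Z p : closed Z ->
  (forall g d, g \is d.-homog -> vanishing_ideal Z g -> vanishes_at g p) -> Z p.
Proof.
move=> [S [homS eZ]] hp; rewrite eZ => g Sg; have [d hd] := homS _ Sg.
by apply: (hp _ d) => // q; rewrite eZ; apply.
Qed.

Lemma closedI Z Z' : closed Z -> closed Z' -> closed (Z `&` Z').
Proof.
move=> [S [homS ->]] [S' [homS' ->]]; exists (S `|` S'); split=> [g [/homS|/homS']//|].
apply/seteqP; split=> [p [h h'] g [/h|/h']//|p h].
by split=> g Sg; apply: h; [left|right].
Qed.

Lemma closed_hypersurface g d : g \is d.-homog -> closed [set p | vanishes_at g p].
Proof.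
move=> hg; exists [set g]; split=> [_ ->|]; first by exists d.
by apply/seteqP; split=> [p h _ ->//|p]; apply.
Qed.

Lemma closed_point p : closed [set p].
Proof.
have [x x0 xp] := point_ex p.
have /rV0Pn[j xj] := x0.
pose l i : R := x 0 j *: 'X_i - x 0 i *: 'X_j.
have hl i : l i \is 1.-homog.
  by apply: rpredB; apply: rpredZ; rewrite dhomogX /= mdeg1.
exists [set l i | i in [set: 'I_N.+1]]; split=> [_ [i _ <-]|]; first by exists 1%N.
apply/seteqP; split=> [_ -> _ [i _ <-]|q hq].
  by apply/(vanishes_atP xp x0 (hl i)); rewrite mevalB !mevalZ !mevalXU mulrC subrr.
have [y y0 yq] := point_ex q.
have e i : x 0 j * y 0 i = x 0 i * y 0 j.
  have := hq (l i) (imageT l i) y yq.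
  by rewrite mevalB !mevalZ !mevalXU => /eqP; rewrite subr_eq0 => /eqP.
apply: val_inj; rewrite /= (point_span yq y0) (point_span xp x0).
apply/eqP; rewrite eqEdim !dim_vline x0 y0 andbT -memvE; apply/vlineP.
exists (y 0 j / x 0 j); apply/rowP => i; rewrite mxE; apply: (mulfI xj).
by rewrite e; field.
Qed.

(** By noetherianity, a closed set being determined by its ideal. *)
Lemma closed_minimal (P : set (set point)) : (forall Z, P Z -> closed Z) -> P !=set0 ->
  exists2 Z, P Z & forall Z', P Z' -> Z' `<=` Z -> Z `<=` Z'.
Proof.
move=> Pcl [Z0 PZ0].
pose PI := [set vanishing_ideal Z | Z in P].
have [_ [Z PZ <-] max] : exists2 M, PI M & forall J, PI J -> M `<=` J -> J `<=` M.
  apply: ideal_maximal => [_ [Z _ <-]|]; first exact: ideal_vanishing.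
  by exists (vanishing_ideal Z0), Z0.
exists Z => // Z' PZ' sub p Zp.
have {}max : vanishing_ideal Z' `<=` vanishing_ideal Z.
  by apply: max => [|g h q /sub]; [exists Z' | apply: h].
by apply: closed_vanishing => [|g d _ /max]; [exact: Pcl | apply].
Qed.

(** Used both for the infinite closed sets and for those on which three
    coordinates are algebraically independent. *)
Lemma minimal_irreducible (large : set (set point)) Z :
    large Z -> closed Z -> ~ large set0 ->
    (forall Z', closed Z' -> large Z' -> Z' `<=` Z -> Z `<=` Z') ->
    (forall A1 A2, large (A1 `|` A2) -> large A1 \/ large A2) ->
  irreducible_set closed Z.
Proof.
move=> lZ cZ l0 min lU; split.
  by apply/set0P/eqP => Z0; apply: l0; rewrite -Z0.
move=> A1 A2 c1 c2 sub.
have : large ((Z `&` A1) `|` (Z `&` A2)) by rewrite -setIUr (setIidl sub).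
case/lU => l; [left|right].
  by have := min _ (closedI cZ c1) l (@subIsetl _ _ _) => h p /h[].
by have := min _ (closedI cZ c2) l (@subIsetl _ _ _) => h p /h[].
Qed.

Lemma irreducible_point p : irreducible_set closed [set p].
Proof.
split; first by exists p.
by move=> A1 A2 _ _ sub; have [h|h] := sub p erefl; [left|right] => _ ->.
Qed.

(** Take a linear form with coefficients [1, t, t ^ 2, ...]: each point excludes
    finitely many values of [t]. *)
Lemma exists_linear_form (s : seq 'rV[F]_N.+1) : (forall x, x \in s -> x != 0) ->
  exists g : R, g \is 1.-homog /\ forall x, x \in s -> g.@[x 0] != 0.
Proof.
move=> s0; pose P x : {poly F} := \poly_(i < N.+1) x 0 (inord i).
have nzP x : x != 0 -> P x != 0.
  move=> /rV0Pn[j xj]; apply/eqP => /polyP/(_ j); rewrite coef_poly ltn_ord coef0.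
  by rewrite inord_val => /eqP; rewrite (negPf xj).
have [t ht] : exists t, (\prod_(x <- s) P x).[t] != 0.
  apply: contrapT => /forallNP h.
  have : \prod_(x <- s) P x = 0.
    by apply: (poly_ext0 char0) => t _; apply/eqP; apply: contrapT => /negP /h.
  move/eqP; rewrite prodf_seq_eq0 => /hasP[x xs /= ].
  by rewrite (negPf (nzP _ (s0 _ xs))).
exists (\sum_(i < N.+1) t ^+ i *: 'X_i); split.
  by apply: rpred_sum => i _; apply: rpredZ; rewrite dhomogX /= mdeg1.
move=> x xs; have := ht; rewrite horner_prod prodf_seq_neq0 => /allP/(_ x xs) /=.
rewrite horner_poly raddf_sum /=; apply: contra => /eqP h; apply/eqP; rewrite -[RHS]h.
by apply: eq_bigr => i _; rewrite mevalZ mevalXU inord_val mulrC.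
Qed.

Definition coordinate_triple x (a b c : 'I_N.+1) : 'rV[F]_3 :=
  \row_(l < 3) [:: x 0 a; x 0 b; x 0 c]`_l.

Definition triple_vanish (a b c : 'I_N.+1) (Q : {mpoly F[3]}) Z :=
  forall p x, Z p -> x \in val p -> Q.@[(coordinate_triple x a b c) 0] = 0.

(** Otherwise take a minimal closed subset [Z2] of [G] on which the three
    coordinates are independent.  Its proper closed subsets are finite, for
    lack of a chain of length [2]; so two linear forms suffice to cut it down
    to the empty set. *)
Lemma curve_coordinates G (a b c : 'I_N.+1) : closed G -> ~ has_chain closed G 2 ->
  exists k (Q : {mpoly F[3]}), [/\ Q != 0, Q \is k.-homog & triple_vanish a b c Q G].
Proof.
move=> cG nchain; apply: contrapT => ndep.
pose dep Z := exists k (Q : {mpoly F[3]}),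
  [/\ Q != 0, Q \is k.-homog & triple_vanish a b c Q Z].
have dep0 : dep set0.
  by exists 0%N, 1; split=> //; rewrite ?oner_eq0 //; exact: dhomog1.
have depU A1 A2 : dep A1 -> dep A2 -> dep (A1 `|` A2).
  move=> [k1 [Q1 [nz1 h1 v1]]] [k2 [Q2 [nz2 h2 v2]]].
  exists (k1 + k2)%N, (Q1 * Q2); split; [by rewrite mulf_neq0 | exact: dhomogM|].
  by move=> p x [Zp|Zp] xp; rewrite mevalM ?(v1 p x Zp xp) ?(v2 p x Zp xp) ?mul0r ?mulr0.
have [Z2 [c2 s2 nd2] min2] : exists2 Z, [/\ closed Z, Z `<=` G & ~ dep Z] &
    forall Z', [/\ closed Z', Z' `<=` G & ~ dep Z'] -> Z' `<=` Z -> Z `<=` Z'.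
  apply: (@closed_minimal [set Z | [/\ closed Z, Z `<=` G & ~ dep Z]]) => [Z []//|].
  by exists G; split.
have irr2 : irreducible_set closed Z2.
  apply: (minimal_irreducible (large := [set Z | ~ dep Z])) => //= [Z' cZ' ndZ' sub|].
  - by apply: min2 => //; split=> //; apply: subset_trans sub s2.
  - by move=> A1 A2 h; apply/not_andP => -[d1 d2]; apply: h; apply: depU.
have closed_in_G Z : closed Z -> Z `<=` G -> closed_in closed G Z.
  by move=> cZ sZ; exists Z; split=> //; rewrite setIidr.
have fin Z : closed Z -> Z `<` Z2 -> finite_set Z.
  move=> cZ [sZ nsZ]; apply: contrapT => infZ.
  have [Z1 [c1 s1 inf1] min1] : exists2 Z', [/\ closed Z', Z' `<=` Z & infinite_set Z'] &
      forall Z'', [/\ closed Z'', Z'' `<=` Z & infinite_set Z''] -> Z'' `<=` Z' -> Z' `<=` Z''.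
    apply: (@closed_minimal [set Z' | [/\ closed Z', Z' `<=` Z & infinite_set Z']]) => [Z' []//|].
    by exists Z; split.
  have irr1 : irreducible_set closed Z1.
    apply: (minimal_irreducible (large := [set Z' | infinite_set Z'])) => //= [Z' cZ' iZ' sub|].
    - by apply: min1 => //; split=> //; apply: subset_trans sub s1.
    - by move=> A1 A2 h; apply/not_andP => -[d1 d2]; apply: h; rewrite finite_setU.
  have [[p Z1p] _] := irr1.
  apply: nchain; exists (fun i => if i is 0%N then [set p] else if i is 1%N then Z1 else Z2).
  have s12 : Z1 `<=` Z2 := subset_trans s1 sZ.
  split=> [[|[|[|//]]] _|[|[|//]] _].
  - split; last exact: irreducible_point.
    by apply: closed_in_G (closed_point p) _ => _ ->; apply/s2/s12.
  - by split=> //; apply: closed_in_G => //; apply: subset_trans s12 s2.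
  - by split=> //; apply: closed_in_G.
  - split=> [_ -> //|sub]; apply: inf1; apply: sub_finite_set sub _; exact: finite_set1.
  - by split=> // sub; apply: nsZ; apply: subset_trans sub s1.
have [[p0 Z2p0] _] := irr2.
have [x0 nz0 x0p0] := point_ex p0.
have /rV0Pn[j x0j] := nz0.
have hX : ('X_j : R) \is 1.-homog by rewrite dhomogX /= mdeg1.
have /finite_seqP[s es] : finite_set (Z2 `&` [set p | vanishes_at ('X_j : R) p]).
  apply: fin; first by apply: closedI => //; apply: closed_hypersurface hX.
  split=> [p []//|/(_ p0 Z2p0)[_ /(vanishes_atP x0p0 nz0 hX)]].
  by rewrite mevalXU => /eqP; rewrite (negPf x0j).
have ex (p : point) : exists x : 'rV[F]_N.+1, x != 0 /\ x \in val p.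
  by have [x x1 x2] := point_ex p; exists x.
have [rep hrep] := choice ex.
have [|g [hg gs]] := @exists_linear_form [seq rep p | p <- s].
  by move=> _ /mapP[p _ ->]; case: (hrep p).
pose S : set R := [set h | vanishing_ideal Z2 h /\ exists d, h \is d.-homog].
have ZX x (nzx : x != 0) : (forall h, S h -> h.@[x 0] = 0) -> Z2 (point_of nzx).
  move=> hx; apply: closed_vanishing => // h d hh Ih.
  by apply/(vanishes_atP (point_of_mem nzx) nzx hh); apply: hx; split=> //; exists d.
have [||k [Q [nzQ hQ vQ]]] := @three_coordinates_dependent F N.+1 unc char0 S 1 'X_j g
  _ isT hX hg _ a b c.
- by move=> h [].
- move=> x Sx xj gx; apply/eqP; apply: contraT => nzx.
  have := ZX x nzx Sx; set p := point_of nzx => Zp.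
  have : p \in s.
    have : (Z2 `&` [set p | vanishes_at ('X_j : R) p]) p.
      by split=> //; apply/(vanishes_atP (point_of_mem nzx) nzx hX).
    by rewrite es.
  move=> ps; have /negP[] := gs _ (map_f rep ps); apply/eqP.
  have [rp0 rpp] := hrep p.
  by have /(vanishes_atP (point_of_mem nzx) nzx hg) := gx; apply.
apply: nd2; exists k, Q; split=> // p x Zp xp; apply: vQ => h [Ih _].
exact: Ih xp.
Qed.

End Points.

(** * Algebraically independent forms on a family of lines *)

Section Compose.
Variables (F : fieldType) (n : nat).

Definition subst_mpoly k (g : 'I_k -> {mpoly F[n]}) (Q : {mpoly F[k]}) : {mpoly F[n]} :=
  mmap (@mpolyC n F) g Q.

Lemma meval_subst_mpoly k (g : 'I_k -> {mpoly F[n]}) Q x :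
  (subst_mpoly g Q).@[x] = Q.@[fun i => (g i).@[x]].
Proof.
rewrite /subst_mpoly /mmap raddf_sum mevalE /=; apply: eq_bigr => m _.
rewrite mevalM mevalC rmorph_prod; congr (_ * _); apply: eq_bigr => i _.
by rewrite rmorphXn.
Qed.

Lemma subst_mpoly_muni k (g : 'I_k.+1 -> {mpoly F[n]}) Q :
  subst_mpoly g Q = \sum_(j < size (muni Q))
    subst_mpoly (fun i => g (widen_ord (leqnSn k) i)) (muni Q)`_j * g ord_max ^+ j.
Proof.
pose w i := widen_ord (leqnSn k) i.
pose phi : {mpoly F[k]} -> {mpoly F[n]} := mmap (@mpolyC n F) (fun i => g (w i)).
have -> : subst_mpoly g Q = (map_poly phi (muni Q)).[g ord_max].
  rewrite muniE raddf_sum horner_sum; apply: eq_bigr => m _ /=.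
  rewrite map_polyZ map_polyXn hornerZ hornerXn /phi /= mmapZ mmapX -mulrA.
  congr (_ * _); rewrite /mmap1 big_ord_recr /=; congr (_ * _).
  by apply: eq_bigr => i _; rewrite mnmE.
rewrite (@horner_coef_wide _ (size (muni Q))) ?size_poly //.
by apply: eq_bigr => j _; rewrite coef_map.
Qed.

End Compose.

Lemma subst_mpolyX (F : fieldType) n (Q : {mpoly F[n]}) : subst_mpoly (fun i => 'X_i) Q = Q.
Proof.
rewrite {2}[Q]mpolyE; apply: eq_bigr => m _.
by rewrite mul_mpolyC mpolyXE_id.
Qed.

Lemma muni_neq0 (F : fieldType) k (Q : {mpoly F[k.+1]}) : Q != 0 -> muni Q != 0.
Proof.
apply: contra => /eqP h; rewrite -[Q]subst_mpolyX subst_mpoly_muni h size_poly0.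
by rewrite big_ord0.
Qed.

Section Lines.
Variables (F : fieldType) (N : nat).
Hypothesis char0 : forall k, k.+1%:R != 0 :> F.
Local Notation line := (proj_line F N).
Local Notation R := {mpoly F[N.+1 * N.+1]}.
Local Notation closed := (@zariski_closed_lines F N).
Implicit Types (L : line) (u v : 'rV[F]_N.+1) (g h : R) (Z : set line).

Lemma line_basis L : exists u v, [/\ u \in val L, v \in val L &
  forall w, w \in val L -> exists s t, w = s *: u + t *: v].
Proof.
case: L => V /= /eqP dV; move: (vbasis V) (vbasisP V); rewrite dV => b bas.
exists b`_0, b`_1; split.
- by apply: (basis_mem bas); rewrite mem_nth // size_tuple.
- by apply: (basis_mem bas); rewrite mem_nth // size_tuple.
move=> w wL; exists (coord b 0 w), (coord b 1 w).
by rewrite {1}(coord_basis bas wL) !big_ord_recl big_ord0 addr0; congr (_ + coord b _ _ *: _); apply/val_inj.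
Qed.

Lemma plucker_eq0 u v : plucker u v = 0 -> exists x s t, u = s *: x /\ v = t *: x.
Proof.
move=> P0; have [->|/rV0Pn[a ua]] := eqVneq u 0.
  by exists v, 0, 1; rewrite scale0r scale1r.
exists u, 1, (v 0 a / u 0 a); rewrite scale1r; split=> //.
apply/rowP => i; rewrite mxE; apply: (mulfI ua).
have : (vec_mx (plucker u v)) a i = 0 by rewrite P0 linear0 mxE.
rewrite mxvecK !mxE !big_ord1 !mxE => /eqP; rewrite subr_eq0 => /eqP ->.
by field.
Qed.

Lemma line_plucker_neq0 L : exists u v, [/\ u \in val L, v \in val L & plucker u v != 0].
Proof.
have [u [v [uL vL gen]]] := line_basis L; exists u, v; split=> //.
apply/eqP => /plucker_eq0[x [s [t [eu ev]]]].
have : (val L <= <[x]>)%VS.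
  apply/subvP => w /gen[a [b ->]]; rewrite eu ev !scalerA -scalerDl.
  by apply/vlineP; eexists.
by move=> /dimvS; rewrite (eqP (valP L)) dim_vline; case: (x != 0).
Qed.

Lemma plucker_line L : exists u v, [/\ u \in val L, v \in val L &
  forall w w', w \in val L -> w' \in val L -> exists c, plucker w w' = c *: plucker u v].
Proof.
have [u [v [uL vL gen]]] := line_basis L; exists u, v; split=> // w w'.
move=> /gen[s [t ->]] /gen[s' [t' ->]]; exists (s * t' - t * s').
rewrite !(pluckerDl, pluckerDr, pluckerZl, pluckerZr) !plucker_id !scaler0 addr0 add0r.
rewrite (plucker_antisym u v); move: (plucker u v) => w0.
by apply/rowP => i; rewrite !mxE; ring.
Qed.

(** The Pluecker map sends a line to a punctual cone [{c P}], on which a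
    polynomial is a univariate polynomial in [c]. *)
Lemma vanishes_at_lineM g h L : vanishes_at_line (g * h) L ->
  vanishes_at_line g L \/ vanishes_at_line h L.
Proof.
have [u [v [uL vL gen]]] := plucker_line L => gh.
have vanE q : restr_line q 0 (plucker u v) = 0 -> vanishes_at_line q L.
  move=> q0 w w' wL w'L; have [c ->] := gen w w' wL w'L.
  by rewrite -[c *: _]add0r -horner_restr_line q0 horner0.
have : restr_line g 0 (plucker u v) * restr_line h 0 (plucker u v) = 0.
  apply: (poly_ext0 char0) => t _; rewrite hornerM !horner_restr_line !add0r.
  by rewrite -pluckerZl -mevalM gh // memvZ.
by move=> /eqP; rewrite mulf_eq0 => /orP[/eqP/vanE|/eqP/vanE]; [left|right].
Qed.

Lemma vanishes_at_lineX g k L : vanishes_at_line (g ^+ k) L -> vanishes_at_line g L.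
Proof.
elim: k => [h|k IH]; last by rewrite exprS => /vanishes_at_lineM[|/IH].
by have := h 0 0 (mem0v _) (mem0v _); rewrite expr0 meval1 => /eqP; rewrite oner_eq0.
Qed.

(** Here [g] is arbitrary: the equations are its homogeneous components. *)
Lemma closed_vanishes_at_line g : closed [set L | vanishes_at_line g L].
Proof.
exists [set pihomog mdeg d g | d in [set: nat]]; split.
  by move=> _ [d _ <-]; exists d; exact: pihomogP.
apply/seteqP; split=> [L gL _ [d _ <-] u v uL vL|L gL u v uL vL].
  by apply: (pihomog_vanish char0) => c; rewrite -pluckerZl gL // memvZ.
rewrite (pihomog_partitionE (leqnn (msize g))) raddf_sum big1 // => d _ /=.
exact: (gL (pihomog mdeg d g) (imageT _ _)).
Qed.

Definition indep_on k (g : 'I_k -> R) Z := forall Q : {mpoly F[k]}, Q != 0 ->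
  exists2 L, Z L & ~ vanishes_at_line (subst_mpoly g Q) L.

(** If [g ord_max] does not vanish on the irreducible set [Z], but does so at points
    where the other [g i] are algebraically independent, then adding it
    preserves the independence: a relation may be divided by [g ord_max] until its
    restriction to [g ord_max = 0] is nontrivial. *)
Lemma indep_on_extend k (g : 'I_k.+1 -> R) Z :
    irreducible_set closed Z ->
    ~ (Z `<=` [set L | vanishes_at_line (g ord_max) L]) ->
    (forall Q : {mpoly F[k]}, Q != 0 -> exists L u v,
      [/\ Z L, u \in val L, v \in val L, (g ord_max).@[plucker u v 0] = 0 &
        (subst_mpoly (fun i => g (widen_ord (leqnSn k) i)) Q).@[plucker u v 0] != 0]) ->
  indep_on g Z.
Proof.
move=> [_ irr] nz low Q nzQ; apply: contrapT => nex.
have allZ L : Z L -> vanishes_at_line (subst_mpoly g Q) L.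
  by move=> ZL; apply: contrapT => h; apply: nex; exists L.
have nzm := muni_neq0 nzQ.
have ex : exists j, (muni Q)`_j != 0.
  by exists (size (muni Q)).-1; rewrite -lead_coefE lead_coef_eq0.
case: (ex_minnP ex) => m cm mmin.
have sm : (m < size (muni Q))%N.
  by rewrite ltnNge; apply: contra cm => /(nth_default 0) ->.
pose gl := fun i => g (widen_ord (leqnSn k) i).
pose h := \sum_(j < size (muni Q) - m) subst_mpoly gl (muni Q)`_(m + j) * g ord_max ^+ j.
have eQ : subst_mpoly g Q = g ord_max ^+ m * h.
  rewrite subst_mpoly_muni.
  rewrite -(big_mkord xpredT (fun j => subst_mpoly gl (muni Q)`_j * g ord_max ^+ j)).
  rewrite (big_cat_nat (n := m)) //=; last exact: ltnW.
  rewrite big_nat_cond big1 ?add0r => [|j]; last first.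
    rewrite andbT => /andP[_ jm].
    have /eqP -> : (muni Q)`_j == 0 by apply: contraTT jm => /mmin; rewrite -leqNgt.
    by rewrite /subst_mpoly mmap0 mul0r.
  rewrite -{1}[m]add0n big_addn big_mkord /h mulr_sumr; apply: eq_bigr => j _.
  by rewrite addnC exprD mulrCA.
have [|sub|sub] := irr _ _ (closed_vanishes_at_line (g ord_max)) (closed_vanishes_at_line h).
- move=> L /allZ; rewrite eQ => /vanishes_at_lineM[/vanishes_at_lineX|]; by [left|right].
- exact: nz.
have [L [u [v [ZL uL vL g0]]]] := low _ cm.
have := sub L ZL u v uL vL; rewrite /h raddf_sum /=.
have s0 : (0 < size (muni Q) - m)%N by rewrite subn_gt0.
rewrite (bigD1 (Ordinal s0)) //= big1 => [|j j0]; last first.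
  rewrite mevalM rmorphXn /= g0 expr0n (_ : (j == 0 :> nat)%N = false) ?mulr0 //.
  by apply: contraNF j0 => /eqP j0; apply/eqP/val_inj.
by rewrite addn0 addr0 expr0 mulr1 => -> /eqP.
Qed.

(** The form [g i.+1] vanishes on the [i]-th member of the chain and not on the
    next one.  The first form is a Pluecker coordinate, which vanishes for
    [u = v = 0]: this vertex plays the part of the set preceding the chain. *)
Lemma chain_indep B k : has_chain closed B k ->
  exists (g : 'I_k.+1 -> R) (e : 'I_k.+1 -> nat),
    (forall i, g i \is (e i).-homog) /\ indep_on g B.
Proof.
move=> [Z [hZ Zlt]].
suff : forall l, (l <= k)%N -> exists (g : 'I_l.+1 -> R) (e : 'I_l.+1 -> nat),
    (forall i, g i \is (e i).-homog) /\ indep_on g (Z l).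
  move=> /(_ k (leqnn k))[g [e [hg ind]]]; exists g, e; split=> // Q /ind[L ZL nv].
  by exists L => //; have [[A [_ eA]] _] := hZ k (leqnn k); move: ZL; rewrite eA => -[].
pose ext T l (s : 'I_l -> T) (t : T) (i : 'I_l.+1) : T :=
  if insub (val i) is Some j then s j else t.
have extw T l (s : 'I_l -> T) t i : ext T l s t (widen_ord (leqnSn l) i) = s i.
  by rewrite /ext (insubT (fun m => m < l)%N (ltn_ord i)) /=; congr (s _); apply/val_inj.
have extm T l (s : 'I_l -> T) t : ext T l s t ord_max = t.
  by rewrite /ext insubF //= ltnn.
have exth l (g : 'I_l -> R) (e : 'I_l -> nat) gn en :
    gn \is en.-homog -> (forall i, g i \is (e i).-homog) ->
    forall i, ext _ l g gn i \is (ext _ l e en i).-homog.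
  by move=> hgn hg i; rewrite /ext; case: insubP.
elim=> [_|l IH lk].
  have [_ irr] := hZ 0%N isT; have [[L ZL] _] := irr.
  have [u [v [uL vL P0]]] := line_plucker_neq0 L.
  have /rV0Pn[j Pj] := P0.
  exists (ext _ 0%N (fun=> 0) 'X_j), (ext _ 0%N (fun=> 0%N) 1%N).
  split; first by apply: exth => [|[]//]; rewrite dhomogX /= mdeg1.
  apply: indep_on_extend => //; rewrite extm.
    by move=> /(_ L ZL)/= /(_ u v uL vL) /eqP; rewrite mevalXU (negPf Pj).
  move=> Q nzQ; exists L, 0, 0; split=> //; rewrite ?mem0v // plucker_id.
    by rewrite mevalXU mxE.
  rewrite [Q]nvar0_mpolyC /subst_mpoly mmapC mevalC.
  by apply: contra nzQ => /eqP Q0; rewrite [Q]nvar0_mpolyC Q0 mpolyC0.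
have [g [e [hg ind]]] := IH (ltnW lk).
have [[A [[S [homS eA]] eZ]] _] := hZ l (ltnW lk).
have [cl irr] := hZ l.+1 lk.
have [sub nsub] := Zlt l lk.
have [L [ZL nZL]] : exists L, Z l.+1 L /\ ~ Z l L.
  apply: contrapT => /forallNP h; apply: nsub => L ZL; apply: contrapT => nZL.
  by apply: (h L).
have BL : B L by move: ZL; have [A' [_ ->]] := cl => -[].
have [gn [Sgn ngn]] : exists gn, S gn /\ ~ vanishes_at_line gn L.
  apply: contrapT => /forallNP h; apply: nZL; rewrite eZ eA; split=> // gn Sgn.
  by apply: contrapT => nv; apply: (h gn).
have [en hgn] := homS _ Sgn.
exists (ext _ l.+1 g gn), (ext _ l.+1 e en); split; first exact: exth.
apply: indep_on_extend => //; rewrite extm; first by move=> /(_ L ZL).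
move=> Q /ind[L' ZL' nv].
have [u [v [uL vL uv]]] : exists u v, [/\ u \in val L', v \in val L' &
    (subst_mpoly g Q).@[plucker u v 0] != 0].
  apply: contrapT => h; apply: nv => u v uL vL; apply/eqP; apply: contraT => uv.
  by exfalso; apply: h; exists u, v.
exists L', u, v; split=> //; first exact: sub.
  by move: ZL'; rewrite eZ eA => -[_ /(_ gn Sgn)]; apply.
rewrite (_ : (fun i => _) = g) //; apply/funext => i; exact: extw.
Qed.

End Lines.

(** * Ultrapowers of an algebraically closed field *)

Section Ultrapower.
Local Open Scope quotient_scope.
Variables (T : Type) (U : set_system T) (UU : UltraFilter U) (F : closedFieldType).

Let UT : U setT. Proof. exact: filterT. Qed.
Let UI A B : U A -> U B -> U (A `&` B). Proof. exact: filterI. Qed.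
Let US A B : A `<=` B -> U A -> U B. Proof. exact: filterS. Qed.

Definition ae_eq (f g : T -> F) : bool := `[< U [set w | f w = g w] >].

Lemma ae_eq_equiv : equiv_class_of ae_eq.
Proof.
split=> [f|f g|g f h].
- by apply/asboolP; apply: US UT.
- by apply/asboolP/asboolP; apply: US => w /esym.
move=> /asboolP fg /asboolP gh; apply/asboolP; apply: US (UI fg gh) => w /= [-> ->] //.
Qed.

Canonical ae_eq_equivrel := EquivRelPack ae_eq_equiv.

Definition ultrapower : Type := {eq_quot ae_eq}%qT.
HB.instance Definition _ := Choice.on ultrapower.
HB.instance Definition _ := EqQuotient.on ultrapower.

Definition germ (f : T -> F) : ultrapower := \pi_ultrapower f.

Lemma germP f g : germ f = germ g <-> U [set w | f w = g w].
Proof. by split=> [/eqmodP/asboolP|h]; [|apply/eqmodP/asboolP]. Qed.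

Lemma germ_repr (x : ultrapower) : germ (repr x) = x.
Proof. by rewrite /germ reprK. Qed.

Lemma germ_ex x : exists f, x = germ f.
Proof. by exists (repr x); rewrite germ_repr. Qed.

Definition lift1 (op : F -> F) (x : ultrapower) := germ (fun w => op (repr x w)).
Definition lift2 (op : F -> F -> F) (x y : ultrapower) := germ (fun w => op (repr x w) (repr y w)).

Lemma repr_germ f : U [set w | repr (germ f) w = f w].
Proof. by apply/germP; rewrite /germ reprK. Qed.

Lemma lift1E op f : lift1 op (germ f) = germ (fun w => op (f w)).
Proof. by apply/germP; apply: US (repr_germ f) => w /= ->. Qed.

Lemma lift2E op f g : lift2 op (germ f) (germ g) = germ (fun w => op (f w) (g w)).
Proof.
by apply/germP; apply: US (UI (repr_germ f) (repr_germ g)) => w /= [-> ->].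
Qed.

Ltac germ_law := repeat (let f := fresh "f" in let x := fresh "x" in
  intros x; let H := fresh in destruct (germ_ex x) as [f H]; rewrite {}H);
  rewrite ?(lift1E, lift2E, lift1E, lift2E); congr germ; apply/funext => w.

Fact addA : associative (lift2 +%R).
Proof. by germ_law; rewrite addrA. Qed.
Fact addC : commutative (lift2 +%R).
Proof. by germ_law; rewrite addrC. Qed.
Fact add0 : left_id (germ (fun=> 0)) (lift2 +%R).
Proof. by germ_law; rewrite add0r. Qed.
Fact addN : left_inverse (germ (fun=> 0)) (lift1 -%R) (lift2 +%R).
Proof. by germ_law; rewrite addNr. Qed.

HB.instance Definition _ := GRing.isZmodule.Build ultrapower addA addC add0 addN.

Fact mulA : associative (lift2 *%R).
Proof. by germ_law; rewrite mulrA. Qed.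
Fact mulC : commutative (lift2 *%R).
Proof. by germ_law; rewrite mulrC. Qed.
Fact mul1 : left_id (germ (fun=> 1)) (lift2 *%R).
Proof. by germ_law; rewrite mul1r. Qed.
Fact mulD : left_distributive (lift2 *%R) +%R.
Proof. by rewrite /GRing.add /=; germ_law; rewrite mulrDl. Qed.
Fact oneN0 : germ (fun=> 1) != 0.
Proof.
apply/eqP => /germP h; have [w /= /eqP] : [set w : T | 1 = 0 :> F] !=set0.
  exact: filter_ex h.
by rewrite oner_eq0.
Qed.

HB.instance Definition _ :=
  GRing.Zmodule_isComNzRing.Build ultrapower mulA mulC mul1 mulD oneN0.

(** An ultrafilter contains a set or its complement. *)
Lemma germ_neq0 f : germ f != 0 -> U [set w | f w != 0].
Proof.
move=> nz; have [h|] := in_ultra_setVsetC [set w | f w = 0] UU.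
  by move/eqP: nz; case; apply/germP.
by apply: US => w /= /eqP.
Qed.

Fact mulV (x : ultrapower) : x != 0 -> lift1 GRing.inv x * x = 1.
Proof.
have [f ->] := germ_ex x => /germ_neq0 h; rewrite lift1E /GRing.mul /= lift2E.
by apply/germP; apply: US h => w /= fw; rewrite mulVf.
Qed.
Fact inv0 : lift1 GRing.inv (0 : ultrapower) = 0.
Proof. by rewrite lift1E; congr germ; apply/funext => w; rewrite invr0. Qed.

HB.instance Definition _ := GRing.ComNzRing_isField.Build ultrapower mulV inv0.

Fact sat_ultrapower : GRing.decidable_field_axiom
  (fun (e : seq ultrapower) (phi : GRing.formula ultrapower) => `[< GRing.holds e phi >]).
Proof. by move=> e phi; exact: asboolP. Qed.

HB.instance Definition _ := GRing.Field_isDecField.Build ultrapower sat_ultrapower.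

Lemma germD f g : germ (fun w => f w + g w) = germ f + germ g.
Proof. by rewrite {2}/GRing.add /= lift2E. Qed.

Lemma germM f g : germ (fun w => f w * g w) = germ f * germ g.
Proof. by rewrite {2}/GRing.mul /= lift2E. Qed.

Lemma germ_sum I (r : seq I) (f : I -> T -> F) :
  germ (fun w => \sum_(i <- r) f i w) = \sum_(i <- r) germ (f i).
Proof.
elim: r => [|i r IH].
  by rewrite big_nil; congr germ; apply/funext => w; rewrite big_nil.
by rewrite big_cons -IH -germD; congr germ; apply/funext => w; rewrite big_cons.
Qed.

Lemma germX f k : germ (fun w => f w ^+ k) = germ f ^+ k.
Proof.
elim: k => [|k IH]; first by congr germ; apply/funext => w; rewrite expr0.
by rewrite exprS -IH -germM; congr germ; apply/funext => w; rewrite exprS.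
Qed.

Lemma germ_prod I (r : seq I) (f : I -> T -> F) :
  germ (fun w => \prod_(i <- r) f i w) = \prod_(i <- r) germ (f i).
Proof.
elim: r => [|i r IH].
  by rewrite big_nil; congr germ; apply/funext => w; rewrite big_nil.
by rewrite big_cons -IH -germM; congr germ; apply/funext => w; rewrite big_cons.
Qed.

Fact closed_ultrapower : GRing.closed_field_axiom ultrapower.
Proof.
move=> n P n0; have [p hp] := choice (fun i => germ_ex (P i)).
have ex w : exists x : F, x ^+ n = \sum_(i < n) p i w * x ^+ i.
  exact: (@solve_monicpoly F n (fun i => p i w) n0).
have [x hx] := choice ex; exists (germ x).
under eq_bigr => i _ do rewrite hp -germX -germM.
by rewrite -germX -germ_sum; congr germ; apply/funext.
Qed.

HB.instance Definition _ := GRing.DecField_isAlgClosed.Build ultrapower closed_ultrapower.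

Definition germ_const (c : F) : ultrapower := germ (fun=> c).

Fact germ_const_zmod : zmod_morphism germ_const.
Proof.
move=> a b; rewrite /germ_const; apply: (addIr (germ (fun=> b))).
by rewrite subrK -germD; congr germ; apply/funext => w; rewrite subrK.
Qed.
Fact germ_const_monoid : monoid_morphism germ_const.
Proof. by split=> // a b; rewrite /germ_const -germM. Qed.
HB.instance Definition _ := GRing.isZmodMorphism.Build F ultrapower germ_const germ_const_zmod.
HB.instance Definition _ := GRing.isMonoidMorphism.Build F ultrapower germ_const germ_const_monoid.

Definition germ_row n (x : T -> 'rV[F]_n) : 'rV[ultrapower]_n := \row_i germ (fun w => x w 0 i).

Lemma germ_row_ex n (x : 'rV[ultrapower]_n) : exists y, x = germ_row y.
Proof.
have [f hf] := choice (fun i => germ_ex (x 0 i)).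
exists (fun w => \row_i f i w); apply/rowP => i; rewrite mxE hf; congr germ.
by apply/funext => w; rewrite mxE.
Qed.

Lemma meval_germ n (p : {mpoly F[n]}) (x : T -> 'rV[F]_n) :
  (map_mpoly germ_const p).@[germ_row x 0] = germ (fun w => p.@[x w 0]).
Proof.
rewrite meval_map_mpoly /mmap.
have -> : (fun w => p.@[x w 0]) =
    (fun w => \sum_(m <- msupp p) (p@_m * \prod_i x w 0 i ^+ m i)).
  by apply/funext => w; rewrite mevalE.
rewrite germ_sum; apply: eq_bigr => m _; rewrite germM germ_prod; congr (_ * _).
by apply: eq_bigr => i _; rewrite mxE germX.
Qed.

Lemma germN f : germ (fun w => - f w) = - germ f.
Proof.
apply: (addIr (germ f)); rewrite addNr -germD.
by congr germ; apply/funext => w; rewrite addNr.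
Qed.

Lemma germ_comb n (x y : T -> 'rV[F]_n) (s t : T -> F) :
  germ_row (fun w => s w *: x w + t w *: y w) =
    germ s *: germ_row x + germ t *: germ_row y.
Proof.
apply/rowP => i; rewrite !mxE -!germM -germD; congr germ.
by apply/funext => w; rewrite !mxE.
Qed.

Lemma germ_row_mulmx k n (y : T -> 'rV[F]_k) (E : T -> 'M[F]_(k, n)) :
  germ_row y *m (\matrix_(i, j) germ (fun w => E w i j)) =
    germ_row (fun w => y w *m E w).
Proof.
apply/rowP => j; rewrite !mxE.
have -> : (fun w => (y w *m E w) 0 j) = (fun w => \sum_i y w 0 i * E w i j).
  by apply/funext => w; rewrite mxE.
by rewrite germ_sum; apply: eq_bigr => i _; rewrite !mxE germM.
Qed.

Lemma germ_plucker n (x y : T -> 'rV[F]_n.+1) :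
  plucker (germ_row x) (germ_row y) = germ_row (fun w => plucker (x w) (y w)).
Proof.
apply/rowP => k; case/mxvec_indexP: k => i j.
rewrite [RHS]mxE /plucker mxvecE !mxE !big_ord1 !mxE -!germM -germN -germD.
by congr germ; apply/funext => w; rewrite mxvecE !mxE !big_ord1 !mxE.
Qed.

(** The members of the family [P] are built on the support of [p], which keeps
    the degree. *)
Lemma meval_germ_coef n (p : {mpoly ultrapower[n]}) d : p \is d.-homog ->
  exists P : T -> {mpoly F[n]}, (forall w, P w \is d.-homog) /\
    forall x, p.@[germ_row x 0] = germ (fun w => (P w).@[x w 0]).
Proof.
move=> /dhomogP hp.
exists (fun w => \sum_(m <- msupp p) repr p@_m w *: 'X_[m]); split.
  move=> w; rewrite big_seq; apply: rpred_sum => m /hp hm; apply: rpredZ.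
  by rewrite dhomogX; apply/eqP.
move=> x; rewrite mevalE.
have -> : (fun w => (\sum_(m <- msupp p) repr p@_m w *: 'X_[m]).@[x w 0]) =
    (fun w => \sum_(m <- msupp p) (repr p@_m w * \prod_i x w 0 i ^+ m i)).
  by apply/funext => w; rewrite raddf_sum; apply: eq_bigr => m _ /=; rewrite mevalZ mevalX.
rewrite germ_sum; apply: eq_bigr => m _; rewrite germM germ_prod germ_repr.
by congr (_ * _); apply: eq_bigr => i _; rewrite mxE germX.
Qed.

Lemma germ_row_neq0 n (x : T -> 'rV[F]_n) : U [set w | x w != 0] -> germ_row x != 0.
Proof.
move=> h; apply/eqP => e.
have hi i : U [set w | x w 0 i = 0].
  by apply/germP; have := congr1 (fun y : 'rV_n => y 0 i) e; rewrite !mxE.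
have : U [set w | x w = 0].
  have h0 : U [set w | forall i, x w 0 i = 0].
    exact: (@filter_forall _ _ (fun i => [set w | x w 0 i = 0]) U _ hi).
  apply: US h0 => w xw;  apply/rowP => i; rewrite mxE; apply: xw.
move=> h'; have [w [/= xw /eqP]] := filter_ex (UI h h'); exact: negP.
Qed.

End Ultrapower.

(** * The family of lines meeting a curve *)

Section BaseField.
Variable F : closedFieldType.
Hypothesis unc : ~ countable [set: F].
Hypothesis char0 : forall k, k.+1%:R != 0 :> F.

Lemma mpoly_fun_eq0 n (Q : {mpoly F[n]}) : (forall x : 'rV_n, Q.@[x 0] = 0) -> Q = 0.
Proof.
elim: n Q => [|n IH] Q Q0.
  by have := Q0 0; rewrite [Q]nvar0_mpolyC mevalC => ->; rewrite mpolyC0.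
apply/eqP; apply: contraT => nzQ; have := muni_neq0 nzQ.
rewrite -lead_coef_eq0; set c := lead_coef _ => nzc.
have [x cx] : exists x : 'rV_n, c.@[x 0] != 0.
  apply: contrapT => /forallNP h; move/eqP: nzc; apply; apply: IH => x.
  by apply/eqP; apply: contrapT => /negP /h.
pose P : {poly F} := \poly_(j < size (muni Q)) ((muni Q)`_j).@[x 0].
have : P = 0.
  apply: (poly_ext0 char0) => t _.
  pose y : 'rV[F]_n.+1 := \row_i (if insub (val i) is Some j then x 0 j else t).
  rewrite -[RHS](Q0 y) -[Q in RHS]subst_mpolyX subst_mpoly_muni raddf_sum horner_poly.
  apply: eq_bigr => j _ /=; rewrite mevalM rmorphXn /= mevalXU mxE insubF ?ltnn //.
  congr (_ * _); rewrite meval_subst_mpoly; apply: meval_eq => i.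
  rewrite mevalXU mxE (insubT (fun m => m < n)%N (ltn_ord i)) /=.
  by congr (x 0 _); apply/val_inj.
move=> /polyP/(_ (size (muni Q)).-1); rewrite coef_poly coef0 -lead_coefE -/c.
by rewrite prednK ?size_poly_gt0 ?muni_neq0 // leqnn => /eqP; rewrite (negPf cx).
Qed.

(** Otherwise three of the coordinates of [F ^ k] would be algebraically
    dependent. *)
Lemma common_zero n m k (a b : {mpoly F[n]}) (E : 'M_(k, n)) :
    (2 < k)%N -> (0 < m)%N -> a \is m.-homog -> b \is m.-homog ->
  exists y : 'rV_k, [/\ y != 0, a.@[(y *m E) 0] = 0 & b.@[(y *m E) 0] = 0].
Proof.
move=> k2 m0 ha hb; pose l j : {mpoly F[k]} := \sum_i E i j *: 'X_i.
have hl j : l j \is 1.-homog.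
  by apply: rpred_sum => i _; apply: rpredZ; rewrite dhomogX /= mdeg1.
have hs (q : {mpoly F[n]}) : q \is m.-homog -> subst_mpoly l q \is m.-homog.
  move=> /dhomogP hq; rewrite /subst_mpoly /mmap big_seq; apply: rpred_sum => mu /hq /= <-.
  rewrite mul_mpolyC; apply: rpredZ; rewrite /mmap1 mdegE.
  elim/big_rec2: _ => [|j p d _ hp]; first exact: dhomog1.
  by apply: dhomogM => //; have := dhomogMn (mu j) (hl j); rewrite mul1n.
have ev (q : {mpoly F[n]}) (y : 'rV_k) : (subst_mpoly l q).@[y 0] = q.@[(y *m E) 0].
  rewrite meval_subst_mpoly; apply: meval_eq => j; rewrite /l raddf_sum mxE.
  by apply: eq_bigr => i _; rewrite /= mevalZ mevalXU mulrC.
apply: contrapT => nex.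
have no_zero (y : 'rV_k) : [set x : 'rV_k | forall g : {mpoly F[k]}, set0 g -> g.@[x 0] = 0] y ->
    (subst_mpoly l a).@[y 0] = 0 -> (subst_mpoly l b).@[y 0] = 0 -> y = 0.
  rewrite !ev => _ ya yb; apply/eqP; apply: contraT => y0.
  by exfalso; apply: nex; exists y.
pose i0 : 'I_k := Ordinal (leq_trans (isT : 0 < 3)%N k2).
pose i1 : 'I_k := Ordinal (leq_trans (isT : 1 < 3)%N k2).
pose i2 : 'I_k := Ordinal k2.
have [//|D [Q [nzQ _ hQ]]] := three_coordinates_dependent unc char0 _ m0 (hs a ha) (hs b hb)
  no_zero i0 i1 i2.
move/eqP: nzQ; apply; apply: mpoly_fun_eq0 => x.
have := hQ (\row_i nth 0 [:: x 0 0; x 0 1; x 0 2] i) (fun g h => False_ind _ h).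
congr (_ = _); apply: meval_eq => i; rewrite !mxE /=.
by case: i => -[|[|[|//]]] lti /=; congr (x 0 _); apply/val_inj.
Qed.

Lemma plucker_through N (L : proj_line F N) (x u v : 'rV[F]_N.+1) :
  x \in val L -> x != 0 -> u \in val L -> v \in val L ->
  exists2 y, y \in val L & plucker x y = plucker u v.
Proof.
move=> xL x0 uL vL.
have [b0 [b1 [b0L b1L gen]]] := line_basis L.
have [s [t ex]] := gen x xL; have [s1 [t1 eu]] := gen u uL; have [s2 [t2 ev]] := gen v vL.
have [c ec] : exists c, plucker u v = c *: plucker b0 b1.
  exists (s1 * t2 - t1 * s2); rewrite eu ev.
  rewrite !(pluckerDl, pluckerDr, pluckerZl, pluckerZr) !plucker_id !scaler0 addr0 add0r.
  rewrite (plucker_antisym b0 b1); move: (plucker b0 b1) => w0.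
  by apply/rowP => i; rewrite !mxE; ring.
have [s0|sn0] := eqVneq s 0; last first.
  exists ((c / s) *: b1); first by rewrite memvZ.
  rewrite ex ec pluckerZr pluckerDl !pluckerZl plucker_id scaler0 addr0 scalerA.
  by rewrite divfK.
have tn0 : t != 0 by apply: contra_neq x0 => t0; rewrite ex s0 t0 !scale0r addr0.
exists (- (c / t) *: b0); first by rewrite memvZ.
rewrite ex ec s0 scale0r add0r pluckerZr pluckerZl plucker_antisym scalerN scaleNr.
by rewrite scalerN opprK scalerA divfK.
Qed.

Variables (r d : nat) (f : {mpoly F[r.+3]}).
Hypothesis d3 : (3 <= d)%N.
Hypothesis hf : f \is d.-homog.
Hypothesis smooth : smooth_hypersurface (f : {mpoly F[(r.+2).+1]}).
Variables (B : set (proj_line F r.+2)) (G : set (proj_point F r.+2)).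
Hypothesis BX : B `<=` fano_lines f.
Hypothesis Bchain : has_chain (@zariski_closed_lines F r.+2) B r.
Hypothesis closedG : zariski_closed G.
Hypothesis curveG : ~ has_chain (@zariski_closed F r.+2) G 2.
Hypothesis meet : forall L, B L -> exists p, G p /\ on_line p L.

Let smooth_affine (x : 'rV[F]_r.+3) : (forall i, f^`M(i).@[x 0] = 0) -> x = 0.
Proof.
move=> df; apply/eqP; apply: contraT => x0.
have fx : f.@[x 0] = 0.
  have := euler char0 x hf; rewrite meval_dirderiv big1 => [/esym/eqP|i _]; last first.
    by rewrite df mulr0.
  rewrite mulf_eq0; case: (d) d3 => // k _; by rewrite (negPf (char0 k)) => /eqP.
have [|i] := smooth (p := point_of x0).
  by apply/(vanishes_atP (point_of_mem x0) x0 hf).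
by case; apply/(vanishes_atP (point_of_mem x0) x0 (dhomog_mderiv i hf)).
Qed.

Definition flag_pairs : set ('rV[F]_r.+3 * 'rV[F]_r.+3) :=
  [set w | [/\ w.1 != 0, exists2 p, G p & w.1 \in val p & vanish_on_span f w.1 w.2]].

(** The second vector is chosen on the line so that the Pluecker vector takes a
    prescribed value, the first one being fixed on the curve. *)
Lemma flag_pairs_dense (g : 'I_r.+1 -> {mpoly F[r.+3 * r.+3]}) Q :
  indep_on (g : 'I_r.+1 -> {mpoly F[(r.+2).+1 * (r.+2).+1]}) B -> Q != 0 ->
  exists2 w, flag_pairs w &
    (subst_mpoly g Q).@[plucker (w.1 : 'rV_(r.+2).+1) w.2 0] != 0.
Proof.
move=> ind /ind[L BL nv].
have [u [v [uL vL uv]]] : exists u v, [/\ u \in val L, v \in val L &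
    (subst_mpoly g Q).@[plucker u v 0] != 0].
  apply: contrapT => h; apply: nv => u v uL vL; apply/eqP; apply: contraT => uv.
  by exfalso; apply: h; exists u, v.
have [p [Gp pL]] := meet BL; have [x x0 xp] := point_ex p.
have xL : x \in val L by apply: subvP xp; exact: pL.
have [y yL exy] := plucker_through xL x0 uL vL.
exists (x, y); last by rewrite /= exy.
split=> //=; first by exists p.
move=> s t; set z := _ + _.
have zL : z \in val L by rewrite memvD ?memvZ.
have [z0|z0] := eqVneq z 0.
  by rewrite z0 -(scale0r 0) (meval_dhomogZ _ _ hf) expr0n; case: (d) d3 => // k _; rewrite mul0r.
have zp := point_of_mem z0.
apply: (BX BL (p := point_of z0)) zp.
by rewrite /on_line /= -memvE.
Qed.


(** The sets where a given nonzero polynomial in the forms [g i] does not vanish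
    have the finite intersection property.  In the ultrapower along an
    ultrafilter that contains them, the germ of the identity is a generic pair
    [(p, v)], to which [core_absurd] applies. *)
Theorem family_absurd : False.
Proof.
have [g [e [hg ind]]] := chain_indep char0 Bchain.
pose P (w : 'rV[F]_r.+3 * 'rV[F]_r.+3) : 'rV[F]_(r.+3 * r.+3) :=
  plucker (w.1 : 'rV_(r.+2).+1) w.2.
pose D Q := [set w | flag_pairs w /\ (subst_mpoly g Q).@[P w 0] != 0].
have FF : Filter (filter_from [set Q | Q != 0] D).
  apply: filter_from_filter => [|Q1 Q2 nz1 nz2]; first by exists 1; exact: oner_neq0.
  exists (Q1 * Q2); first by rewrite /= mulf_neq0.
  move=> w [Ww]; rewrite /subst_mpoly rmorphM /= mevalM mulf_eq0 negb_or => /andP[h1 h2].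
  by split; split.
have PF : ProperFilter (filter_from [set Q | Q != 0] D).
  apply: filter_from_proper => Q nzQ.
  by have [w Ww nz] := flag_pairs_dense ind nzQ; exists w.
have [U [UU subU]] := ultraFilterLemma PF.
pose K := ultrapower UU F; pose iota : {rmorphism F -> K} := @germ_const _ U UU F.
have UD Q : Q != 0 -> U (D Q) by move=> nzQ; apply: subU; exists Q.
have UW : U flag_pairs.
  by apply: filterS (UD 1 (oner_neq0 _)) => w [].
have charK k : k.+1%:R != 0 :> K.
  by rewrite -(rmorph_nat iota) fmorph_eq0.
pose p0 : 'rV[K]_r.+3 := germ_row UU (fun w => w.1).
pose v0 : 'rV[K]_r.+3 := germ_row UU (fun w => w.2).
have p0_neq0 : p0 != 0 by apply: germ_row_neq0; apply: filterS UW => w [].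
have /rV0Pn[j0 cn0] := p0_neq0; set c := p0 0 j0 in cn0.
(* Normalize a coordinate of [p], without changing the Pluecker vector. *)
pose p := c^-1 *: p0; pose v := c *: v0.
have pj0 : p 0 j0 = 1 by rewrite mxE mulVf.
have line : vanish_on_span (map_mpoly iota f) p v.
  move=> s t; rewrite /p /v !scalerA.
  have [s' ->] := germ_ex (s * c^-1); have [t' ->] := germ_ex (t * c).
  rewrite -germ_comb meval_germ; apply/germP; apply: filterS UW => w [_ _ h] /=.
  exact: h.
have ePl : plucker (p : 'rV_(r.+2).+1) v = germ_row UU P.
  by rewrite /p /v pluckerZl pluckerZr scalerA mulVf // scale1r germ_plucker.
have eG (q : {mpoly F[r.+1]}) :
    mmap iota (fun i => (map_mpoly iota (g i)).@[plucker (p : 'rV_(r.+2).+1) v 0]) q =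
    germ UU (fun w => (subst_mpoly g q).@[P w 0]).
  have -> : (fun w => (subst_mpoly g q).@[P w 0]) =
      (fun w => q.@[(\row_i (g i).@[P w 0]) 0]).
    apply/funext => w; rewrite meval_subst_mpoly; apply: meval_eq => i.
    by rewrite mxE.
  rewrite -meval_germ -meval_map_mpoly; apply: meval_eq => i.
  rewrite ePl meval_germ mxE; congr germ; apply/funext => w.
  by rewrite mxE.
have indep (q : {mpoly F[r.+1]}) :
    mmap iota (fun i => (map_mpoly iota (g i)).@[plucker (p : 'rV_(r.+2).+1) v 0]) q = 0 -> q = 0.
  rewrite eG => /germP q0; apply/eqP; apply: contraT => nzq.
  have [w [/= h [_ nz]]] := filter_ex (filterI q0 (UD q nzq)).
  by rewrite h eqxx in nz.
have smoothK (x : 'rV[K]_r.+3) : gradient (map_mpoly iota f) x = 0 -> x = 0.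
  have [y ->] := germ_row_ex x => gx; apply/eqP; apply: contraT => nz.
  have h0 : U [set w | forall i, f^`M(i).@[y w 0] = 0].
    apply: (@filter_forall _ _ (fun i => [set w | f^`M(i).@[y w 0] = 0]) U _) => i.
    have := congr1 (fun A : 'cV_ _ => A i 0) gx; rewrite !mxE mderiv_map_mpoly meval_germ.
    by move/germP.
  move/eqP: nz; case; apply/rowP => i; rewrite !mxE; apply/germP.
  by apply: filterS h0 => w /smooth_affine yw /=; rewrite yw mxE.
have zeroK m k (a b : {mpoly K[r.+3]}) (E : 'M_(k, r.+3)) :
    (2 < k)%N -> (0 < m)%N -> a \is m.-homog -> b \is m.-homog ->
    exists y : 'rV_k, [/\ y != 0, a.@[(y *m E) 0] = 0 & b.@[(y *m E) 0] = 0].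
  move=> k2 m0 /meval_germ_coef[a' [ha' ea]] /meval_germ_coef[b' [hb' eb]].
  pose E' w := \matrix_(i, j) repr (E i j) w.
  have eE : E = \matrix_(i, j) germ UU (fun w => E' w i j).
    apply/matrixP => i j; rewrite mxE -[LHS]germ_repr; congr germ.
    by apply/funext => w; rewrite mxE.
  have [y hy] := choice (fun w => common_zero (E' w) k2 m0 (ha' w) (hb' w)).
  exists (germ_row UU y); rewrite eE germ_row_mulmx ea eb; split.
  - by apply: germ_row_neq0; apply: filterS (@filterT _ U _) => w _; case: (hy w).
  - by apply/germP; apply: filterS (@filterT _ U _) => w _; case: (hy w).
  - by apply/germP; apply: filterS (@filterT _ U _) => w _; case: (hy w).
have prop delta eta : derivation_over iota delta -> derivation_over iota eta ->
    forall a b, delta (p 0 a) * eta (p 0 b) = delta (p 0 b) * eta (p 0 a).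
  move=> hdelta heta a b.
  have [k [Q [nzQ hQ vQ]]] := curve_coordinates unc char0 a b j0 closedG curveG.
  pose q : 'rV[K]_3 := \row_(l < 3) [:: p 0 a; p 0 b; p 0 j0]`_l.
  have eq : q = c^-1 *: germ_row UU (fun w => coordinate_triple w.1 a b j0).
    apply/rowP => i; rewrite !mxE.
    by case: i => -[|[|[|//]]] lti /=; rewrite ?mxE; congr (_ * germ _ _);
      apply/funext => w; rewrite !mxE.
  have q2 : q 0 2 = 1 by rewrite mxE /= pj0.
  have Qq : (map_mpoly iota Q).@[q 0] = 0.
    rewrite eq (meval_dhomogZ _ _ (dhomog_map_mpoly iota hQ)) meval_germ.
    rewrite (_ : germ _ _ = 0) ?mulr0 //; apply/germP.
    by apply: filterS UW => w [_ [x Gx wx] _] /=; apply: vQ wx.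
  have := derivation_plane_curve charK nzQ hQ q2 Qq hdelta heta.
  by rewrite !mxE.
exact: (core_absurd charK d3 hf smoothK zeroK pj0 line prop hg indep).
Qed.

End BaseField.

Theorem corollary4p3 (R : realType) (N d : nat) (hN : (2 <= N)%N)
  (hd : (3 <= d)%N) (f : {mpoly R[i][N.+1]}) (hf : f \is d.-homog)
  (hsmooth : smooth_hypersurface f) :
  ~ exists (B : set (proj_line R[i] N)) (G : set (proj_point R[i] N)),
      [/\ B `<=` fano_lines f,
          krull_dim_eq (@zariski_closed_lines R[i] N) B (N - 2),
          is_curve G,
          G `<=` hypersurface f
        & forall L, B L -> exists p, G p /\ on_line p L].
Proof.
case: N hN f hf hsmooth => [|[|r]] // _ f hf smooth [B [G [BX dimB curveG _ meet]]].
have {dimB} [chainB _] := dimB; rewrite !subSS subn0 in chainB.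
have [closedG [_ nchainG]] := curveG.
have char0 k : k.+1%:R != 0 :> R[i] by rewrite pnatr_eq0.
exact: (family_absurd (@uncountable_complex R) char0 hd hf smooth BX chainB closedG nchainG meet).
Qed.
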